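(* Let $\Lambda$ be a mother process, let $b>1$, and let $A_n(t)$, $A(t)$, $t\in[0,1]$, be the associated cumulative processes and their limit (see context). Let $q\ge2$ be an integer and put $$\rho(u_1,\ldots,u_{q-1})=\mathrm{E}\,\Lambda(0)\Lambda(u_1)\Lambda(u_1+u_2)\cdots\Lambda(u_1+\cdots+u_{q-1}),\qquad u_1,\dots,u_{q-1}\ge0.$$ Assume that $\rho(u_1,\ldots,u_{q-1})$ is monotone decreasing in all variables, that $$b^{q-1}>\mathrm{E}\,\Lambda(0)^q ,$$ that $$\sum_{n=1}^\infty\bigl(\rho(b^n,\ldots,b^n)-1\bigr)<\infty ,$$ and that the following mixing condition holds: for every $m<q-1$ and every set of indices $\mathcal{C}=\{i_1,\ldots,i_m\}$ with $1\le i_1<\cdots<i_m\le q-1$, if $u_j=A$ for $j\in\mathcal{C}$ and $u_j=0$ for $j\notin\mathcal{C}$, then $$\lim_{A\to\infty}\rho(u_1,\ldots,u_{q-1})=\mathrm{E}\Lambda(0)^{i_1}\,\mathrm{E}\Lambda(0)^{i_2-i_1}\cdots\mathrm{E}\Lambda(0)^{q-i_m}.$$ Then, for each fixed $t\in[0,1]$, $$\mathrm{E}A(t)^q<\infty,$$ and $A_n(t)$ converges to $A(t)$ in $\mathcal{L}_q$ (and hence in $\mathcal{L}_{\widetilde q}$ for $\widetilde q\in[0,q]$) as $n\to\infty$.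
   Context: Mother process: $\Lambda(t)$, $t\in\mathbb{R}_+=[0,\infty)$, is a measurable, separable, strictly stationary, positive stochastic process with $\mathrm{E}\Lambda(t)=1$. Let $\Lambda^{(i)}$, $i=0,1,2,\dots$, be independent copies of $\Lambda$, let $b>1$ be the scaling parameter, and let $\Lambda_b^{(i)}(t)=\Lambda^{(i)}(tb^i)$ (equality in finite-dimensional distributions) be the rescaled copies, independent in $i$. Define $$\Lambda_n(t)=\prod_{i=0}^n\Lambda_b^{(i)}(t),\qquad A_n(t)=\int_0^t\Lambda_n(s)\,ds,\qquad n=0,1,2,\dots,\ t\in[0,1].$$ It is assumed that $A_n(t)$ is a c\`adl\`ag process in $t$. For fixed $t$ the sequence $(A_n(t))_n$ is a non-negative martingale, and $A(t)$ denotes its almost sure limit as $n\to\infty$. Index sets $\mathcal C$ in the mixing condition are nonempty ($m\ge1$). Convergence in $\mathcal{L}_p$, $p>0$, means $\mathrm{E}|A_n(t)-A(t)|^p\to0$; $\mathcal{L}_0$ convergence is understood as convergence in probability. *)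

(* Defs.v *)
(* MathComp-Analysis.  A process on Omega with time set [0, +oo) is a function
   X : R -> Omega -> R; every condition below constrains it only at times >= 0. *)
From HB Require Import structures.
From mathcomp Require Import all_boot all_order all_algebra.
From mathcomp Require Import all_classical all_reals all_analysis.
Set Implicit Arguments.
Unset Strict Implicit.
Unset Printing Implicit Defensive.
Import Order.TTheory GRing.Theory Num.Theory.
Import numFieldNormedType.Exports.
Local Open Scope classical_set_scope.
Local Open Scope ring_scope.

Section processes.
Context {d : measure_display} {T : measurableType d} {R : realType}.
Variable P : probability T R.

Definition measurable_process (X : R -> T -> R) : Prop :=
  measurable_fun ([set t : R | 0 <= t] `*` [set: T])
    (fun p : R * T => X p.1 p.2).

(* Separability in Doob's sense, relative to the closed sets: outside one
   negligible set N, staying in a closed set F at the times of I `&` S forces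
   staying in F at all the times of the open interval I. *)
Definition separable_process (X : R -> T -> R) : Prop :=
  exists S : set R, exists N : set T,
    [/\ S `<=` [set t | 0 <= t], countable S,
        [set t | 0 <= t] `<=` closure S,
        P.-negligible N &
        forall (x y : R) (F : set R), closed F ->
          [set w | forall s, S s -> x < s < y -> F (X s w)] `\`
          [set w | forall t, 0 <= t -> x < t < y -> F (X t w)] `<=` N].

Definition positive_process (X : R -> T -> R) : Prop :=
  forall t w, 0 <= t -> 0 < X t w.

Definition fdd (X : R -> T -> R) (n : nat) (t : n.-tuple R) (w : T) :
    n.-tuple R :=
  [tuple X (tnth t i) w | i < n].

Definition stationary_process (X : R -> T -> R) : Prop :=
  forall (h : R) (n : nat) (t : n.-tuple R) (B : set (n.-tuple R)),
    0 <= h -> (forall i, 0 <= tnth t i) -> measurable B ->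
    P (fdd (fun s => X (s + h)) t @^-1` B) = P (fdd X t @^-1` B).

Definition mother_process (X : R -> T -> R) : Prop :=
  [/\ measurable_process X, separable_process X, stationary_process X,
      positive_process X & forall t, 0 <= t -> ('E_P[X t] = 1)%E].

Definition process_sigma_algebra (X : R -> T -> R) : set (set T) :=
  <<s [set E | exists t B, [/\ 0 <= t, measurable B & E = X t @^-1` B]] >>.

Definition independent_processes (X : nat -> R -> T -> R) : Prop :=
  forall (J : seq nat) (E : nat -> set T), uniq J ->
    (forall i, i \in J -> process_sigma_algebra (X i) (E i)) ->
    P (\bigcap_(i in [set` J]) E i) = (\prod_(i <- J) P (E i))%E.

Definition Lambda_prod (L : nat -> R -> T -> R) (n : nat) (t : R) (w : T) : R :=
  \prod_(i < n.+1) L i t w.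

(* The real-valued integral is 0 where the extended one is +oo; for the
   processes considered here the latter has mean t, so this occurs only on a
   null set. *)
Definition cumulative_process (L : nat -> R -> T -> R) (n : nat) (t : R) (w : T) : R :=
  (\int[lebesgue_measure]_(s in `[0%R, t]) Lambda_prod L n s w)%R.

(* u_j is represented by u at the ordinal j - 1, so that the k-th factor of the
   product, 0 <= k < q, is taken at time u_1 + ... + u_k. *)
Definition rho (X : R -> T -> R) (q : nat) (u : 'I_q.-1 -> R) : \bar R :=
  ('E_P[fun w => (\prod_(k < q) X (\sum_(j < q.-1 | (j < k)%N) u j) w)%R])%E.

Definition moment0 (X : R -> T -> R) (k : nat) : \bar R :=
  ('E_P[fun w => (X 0 w ^+ k)%R])%E.

Definition rho_decreasing (X : R -> T -> R) (q : nat) : Prop :=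
  forall u v : 'I_q.-1 -> R,
    (forall j, 0 <= u j) -> (forall j, u j <= v j) ->
    (rho X v <= rho X u)%E.

(* The set C = {i_1 < ... < i_m} is given by the increasing list of its
   elements; the exponents are the successive differences in 0, i_1, ..., i_m, q. *)
Definition mixing (X : R -> T -> R) (q : nat) : Prop :=
  forall C : seq nat,
    sorted ltn C -> all (fun i => (1 <= i <= q.-1)%N) C ->
    (1 <= size C)%N -> (size C < q.-1)%N ->
    rho X (fun j : 'I_q.-1 => if j.+1 \in C then a else 0)
      @[a --> +oo] -->
    (\prod_(k <- pairmap (fun i j => (j - i)%N) 0%N (rcons C q)) moment0 X k)%E.

Definition cvg_Lp (Y : nat -> T -> R) (Z : T -> R) (p : R) : Prop :=
  if p == 0 then
    forall e : R, 0 < e -> P [set w | e <= `|Y n w - Z w|] @[n --> \oo] --> 0%E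
  else ('E_P[fun w => (`|Y n w - Z w| `^ p)%R])%E @[n --> \oo] --> 0%E.

End processes.

(* Equality of all finite-dimensional distributions; the two processes may live
   on different probability spaces. *)
Definition eq_fdd {d d' : measure_display} {T : measurableType d}
    {T' : measurableType d'} {R : realType} (P : probability T R)
    (P' : probability T' R) (X : R -> T -> R) (X' : R -> T' -> R) : Prop :=
  forall (n : nat) (t : n.-tuple R) (B : set (n.-tuple R)),
    (forall i, 0 <= tnth t i) -> measurable B ->
    P (fdd X t @^-1` B) = P' (fdd X' t @^-1` B).

(* L i is a version of the i-th rescaled copy t |-> X^(i) (t * b ^ i) of the
   mother process X. *)
Definition rescaled_copies {d d' : measure_display} {T : measurableType d}
    {T' : measurableType d'} {R : realType} (P : probability T R)
    (P' : probability T' R) (X : R -> T -> R) (b : R)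
    (L : nat -> R -> T' -> R) : Prop :=
  (forall i, [/\ measurable_process (L i), separable_process P' (L i),
                 positive_process (L i) &
                 eq_fdd P' P (L i) (fun t => X (t * b ^+ i))]) /\
  independent_processes P' L.

Definition cadlag01 {R : realType} (f : R -> R) : Prop :=
  (forall t, 0 <= t < 1 -> f x @[x --> t^'+] --> f t) /\
  (forall t, 0 < t <= 1 -> cvg (f x @[x --> t^'-])).

(* Main.v *)
(* Fix n.  Expanding A_n(t)^q over ordered times, E A_n(t)^q is q! times the integral
   over s_1 < ... < s_q <= t of E Lambda_n(s_1) ... Lambda_n(s_q), which by
   independence, scaling and stationarity is the product over the levels i <= n of
   rho(b^i u_1, ..., b^i u_(q-1)), u_j being the gaps.  At level i call u_j small
   when b^i u_j < B.  If all the gaps are large, the factors at these levels have a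
   bounded product by the summability condition.  Otherwise monotonicity, mixing and
   the interpolation E Lambda(0)^k <= theta^(k-1) bound the factor by theta to the
   number of small gaps, for some theta < b.  Hence the product is at most
   K g(u_1) ... g(u_(q-1)) with g(u) = theta^(number of i <= n with b^i u < B), whose
   integral over [0, 1] is bounded in n because theta < b.
   Given this bound, the martingale identity E A_n^(q-1) A_m = E A_n^q (n <= m)
   passes to the limit m -> oo and gives E A_n^q <= E A^q by convexity; since
   |A_n - A|^q + 2 min(A_n, A)^q <= A_n^q + A^q, dominated convergence applied to
   min(A_n, A)^q <= A^q gives convergence in L_q without a maximal inequality. *)
Require Import Defs.
From HB Require Import structures.
From mathcomp Require Import all_boot all_order all_algebra.
From mathcomp Require Import all_classical all_reals all_analysis.
From mathcomp Require Import measurable_realfun ring lra zify.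
Import Order.TTheory GRing.Theory Num.Theory.
Import numFieldNormedType.Exports.
Set Implicit Arguments.
Unset Strict Implicit.
Unset Printing Implicit Defensive.
Local Open Scope classical_set_scope.
Local Open Scope ring_scope.

(** * Convergence of L_q-bounded martingales *)

Lemma cvg_minr {R : realType} (u v : nat -> R) (a b : R) :
  u n @[n --> \oo] --> a -> v n @[n --> \oo] --> b ->
  Num.min (u n) (v n) @[n --> \oo] --> Num.min a b.
Proof.
move=> ua vb.
have -> : (fun n => Num.min (u n) (v n)) =
    (fun n => (u n + v n - `|u n - v n|) / 2).
  by apply/funext => n; rewrite minr_absE.
rewrite minr_absE; apply: cvgMr_tmp; apply: cvgB; first exact: cvgD.
by apply: cvg_norm; exact: cvgB.
Qed.

Lemma cvg_exprn {R : realType} (u : nat -> R) (a : R) (k : nat) :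
  u n @[n --> \oo] --> a -> u n ^+ k @[n --> \oo] --> a ^+ k.
Proof.
move=> ua; elim: k => [|k IH].
  by under eq_fun do rewrite expr0; exact: cvg_cst.
by under eq_fun do rewrite exprS; rewrite exprS; exact: cvgM.
Qed.

(** Induction on [p]: [x] times the previous inequality is added to
    [(y - x) * (y ^+ p.+1 - x ^+ p.+1) >= 0]. This is the convexity input of [moment_le_limit]. *)
Lemma exprM_weighted_AMGM {R : realDomainType} (x y : R) (p : nat) :
  0 <= x -> 0 <= y ->
  p.+1%:R * (x ^+ p * y) <= y ^+ p.+1 + p%:R * x ^+ p.+1.
Proof.
move=> x0 y0; elim: p => [|p IH].
  by rewrite expr0 !mul1r mul0r addr0 expr1.
have h : 0 <= (y - x) * (y ^+ p.+1 - x ^+ p.+1).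
  have [xy|/ltW yx] := lerP x y.
    by rewrite mulr_ge0 ?subr_ge0 ?lerXn2r ?nnegrE.
  by rewrite mulr_le0 ?subr_le0 ?lerXn2r ?nnegrE.
have := ler_wpM2l x0 IH.
have -> : p.+2%:R = p%:R + 2 :> R by rewrite -addn2 natrD.
have -> : p.+1%:R = p%:R + 1 :> R by rewrite -addn1 natrD.
rewrite !exprS in h *.
set X := x ^+ p in h *; set Y := y ^+ p in h *; set n := p%:R : R.
nra.
Qed.

(** By symmetry [x <= y], and the claim becomes superadditivity of the power: d^q + x^q <= (d + x)^q
    with d = y - x. *)
Lemma expr_distD {R : realDomainType} (x y : R) (q : nat) :
  0 <= x -> 0 <= y -> (0 < q)%N ->
  `|x - y| ^+ q + Num.min x y ^+ q *+ 2 <= x ^+ q + y ^+ q.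
Proof.
wlog xy : x y / x <= y => [H|x0 y0 q0].
  move=> x0 y0 q0; have /orP[xy|yx] := le_total x y; first exact: H.
  by rewrite distrC minC [leRHS]addrC; exact: H.
rewrite distrC ger0_norm ?subr_ge0// (min_idPl xy) mulr2n addrA [leRHS]addrC.
rewrite lerD2r -[leRHS](subrK (x ^+ q)) lerD2r.
case: q q0 => // q _; have d0 : 0 <= y - x by rewrite subr_ge0.
rewrite -{2}(subrK x y); move: (y - x) d0 => d d0; elim: q => [|q IH].
  by rewrite !expr1 addrK.
rewrite lerBrDr in IH; rewrite lerBrDr [leRHS]exprS.
have dx : 0 <= d + x by rewrite addr_ge0.
apply: le_trans (ler_wpM2l dx IH).
rewrite !(exprS _ q.+1) mulrDr !mulrDl lerD// ?lerDl ?lerDr ?mulr_ge0 ?exprn_ge0//.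
Qed.

Section Lq_convergence.
Context {d : measure_display} {T : measurableType d} {R : realType}.
Variables (P : probability T R) (Y : nat -> T -> R) (Z : T -> R) (p : nat).
Variable S : R.
Hypothesis p0 : (0 < p)%N.
Hypothesis mY : forall n, measurable_fun [set: T] (Y n).
Hypothesis Y0 : forall n w, 0 <= Y n w.
Hypothesis mZ : measurable_fun [set: T] Z.
Hypothesis Z0 : forall w, 0 <= Z w.
Hypothesis cvgYZ : {ae P, forall w, Y n w @[n --> \oo] --> Z w}.
Hypothesis YS : forall n, (\int[P]_w (Y n w ^+ p.+1)%:E <= S%:E)%E.
(** The martingale property in integrated form, tested against [Y n ^+ p]; it stands in for
    filtrations and conditional expectations. *)
Hypothesis martY : forall n m, (n <= m)%N ->
  (\int[P]_w (Y n w ^+ p * Y m w)%:E = \int[P]_w (Y n w ^+ p.+1)%:E)%E.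

Let mYX n k : measurable_fun [set: T] (fun w => Y n w ^+ k).
Proof. exact: measurable_funX. Qed.

Let intY_fin n : (\int[P]_w (Y n w ^+ p.+1)%:E)%E \is a fin_num.
Proof.
rewrite ge0_fin_numE; first exact: le_lt_trans (YS n) (ltry _).
by apply: integral_ge0 => w _; rewrite lee_fin exprn_ge0.
Qed.

Let integrableY n c : P.-integrable [set: T] (fun w => (c * Y n w ^+ p.+1)%:E).
Proof.
have -> : (fun w => (c * Y n w ^+ p.+1)%:E) = (fun w => c%:E * (Y n w ^+ p.+1)%:E)%E.
  by apply/funext => w; rewrite EFinM.
apply: integrableZl => //; apply/integrableP; split.
  exact/measurable_EFinP.
under eq_integral do rewrite gee0_abs ?lee_fin ?exprn_ge0//.
by rewrite -ge0_fin_numE ?intY_fin//; apply: integral_ge0 => w _; rewrite lee_fin exprn_ge0.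
Qed.

Lemma fatou_limit : (\int[P]_w (Z w ^+ p.+1)%:E <= S%:E)%E.
Proof.
have -> : (\int[P]_w (Z w ^+ p.+1)%:E =
           \int[P]_w (limn_einf (fun n => (Y n w ^+ p.+1)%:E)))%E.
  apply: ae_eq_integral => //.
  - by apply/measurable_EFinP/measurable_funX.
  (* Measurability of the lower limit is obtained from that of the upper limit by negation. *)
  - have -> : (fun w => limn_einf (fun n => (Y n w ^+ p.+1)%:E)) =
        (\- (fun w => limn_esup (fun n => - (Y n w ^+ p.+1)%:E)))%E.
      apply/funext => w /=; rewrite -limn_einfN; congr limn_einf.
      by apply/funext => n /=; rewrite opprK.
    apply: measurableT_comp; first exact: oppe_measurable.
    apply: measurable_fun_limn_esup => n.
    by apply: measurableT_comp; [exact: oppe_measurable|exact/measurable_EFinP].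
  - apply: filterS cvgYZ => w YZ _.
    have /cvg_limn_einf_sup [-> _//] : (Y n w ^+ p.+1)%:E @[n --> \oo] --> (Z w ^+ p.+1)%:E.
    by apply: cvg_EFin; [exact: nearW|exact: cvg_exprn].
apply: le_trans (fatou _ _ _ _) _ => //.
- by move=> n; apply/measurable_EFinP.
- by move=> n w _; rewrite lee_fin exprn_ge0.
- rewrite limn_einf_lim; apply: lime_le; first exact: is_cvg_einfs.
  by apply: nearW => n; apply: le_trans (YS n); apply: ereal_inf_lbound; exists n => /=.
Qed.

Let intZ_fin : (\int[P]_w (Z w ^+ p.+1)%:E)%E \is a fin_num.
Proof.
rewrite ge0_fin_numE; first exact: le_lt_trans fatou_limit (ltry _).
by apply: integral_ge0 => w _; rewrite lee_fin exprn_ge0.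
Qed.

(* A family bounded in L^(p+1) is uniformly integrable against [Y n ^+ p]:
   where [Y m > C Y n] one has [Y n ^+ p * Y m <= Y m ^+ p.+1 / C ^+ p]. *)
Let weak_limit n :
  (\int[P]_w (Y n w ^+ p.+1)%:E <= \int[P]_w (Y n w ^+ p * Z w)%:E)%E.
Proof.
apply/lee_addgt0Pr => e e0.
(* As [C >= 1] and [p >= 1], one has [C ^+ p >= C >= S / e], so the truncation error [S / C ^+ p] is
   at most [e]. *)
pose C := Num.max 1 (S / e).
have C1 : 1 <= C by rewrite le_max lexx.
have C0 : 0 < C by exact: lt_le_trans C1.
have SC : S / C ^+ p <= e.
  rewrite ler_pdivrMr ?exprn_gt0// mulrC -ler_pdivrMr//.
  apply: (@le_trans _ _ C); first by rewrite le_max lexx orbT.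
  by rewrite -{1}(expr1 C) ler_weXn2l.
(* The truncation level [C * Y n ^+ p.+1] is integrable and independent of [m], so dominated
   convergence applies as [m] tends to infinity. *)
pose f m w := (Num.min (Y n w ^+ p * Y m w) (C * Y n w ^+ p.+1))%:E.
pose f' w := (Num.min (Y n w ^+ p * Z w) (C * Y n w ^+ p.+1))%:E.
have mf m : measurable_fun [set: T] (f m).
  apply/measurable_EFinP; apply: measurable_minr; first exact: measurable_funM.
  exact: measurable_funM.
have mf' : measurable_fun [set: T] f'.
  apply/measurable_EFinP; apply: measurable_minr; first exact: measurable_funM.
  exact: measurable_funM.
have f0 m w : (0 <= f m w)%E.
  by rewrite lee_fin le_min !mulr_ge0 ?exprn_ge0// ltW.
have f'0 w : (0 <= f' w)%E.
  by rewrite lee_fin le_min !mulr_ge0 ?exprn_ge0// ltW.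
have ff' : (\int[P]_w f m w @[m --> \oo] --> \int[P]_w f' w)%E.
  have [] := @dominated_convergence _ _ _ P setT measurableT f f'
    (fun w => (C * Y n w ^+ p.+1)%:E) mf mf' => //.
  - apply: filterS cvgYZ => w YZ _.
    apply: cvg_EFin; first exact: nearW.
    apply: cvg_minr; last exact: cvg_cst.
    by apply: cvgM => //; exact: cvg_cst.
  - apply: aeW => w m _; rewrite gee0_abs// lee_fin ge_min lexx orbT//.
have le1 : (\int[P]_w f' w <= \int[P]_w (Y n w ^+ p * Z w)%:E)%E.
  apply: ge0_le_integral => //.
  - by apply/measurable_EFinP; exact: measurable_funM.
  - by move=> w _; rewrite lee_fin ge_min lexx.
apply: (@le_trans _ _ (\int[P]_w f' w + e%:E)%E); last exact: leeD.
have H : \forall m \near \oo,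
    (\int[P]_w (Y n w ^+ p.+1)%:E <= \int[P]_w f m w + e%:E)%E.
  near=> m.
  have nm : (n <= m)%N by near: m; exact: nbhs_infty_ge.
  rewrite -(martY nm).
  apply: (@le_trans _ _ (\int[P]_w (f m w + (C ^- p * Y m w ^+ p.+1)%:E))%E).
    apply: ge0_le_integral => //.
    - by move=> w _; rewrite lee_fin mulr_ge0// exprn_ge0.
    - by apply/measurable_EFinP; exact: measurable_funM.
    - apply: emeasurable_funD => //.
      by apply/measurable_EFinP; exact: measurable_funM.
    - move=> w _; rewrite -EFinD lee_fin.
      have [le|gt] := lerP (Y m w) (C * Y n w).
        have le' : Y n w ^+ p * Y m w <= C * Y n w ^+ p.+1.
          by rewrite exprSr mulrCA ler_wpM2l ?exprn_ge0.
        by rewrite (min_idPl le') lerDl mulr_ge0 ?invr_ge0 ?exprn_ge0// ltW.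
      rewrite ler_wpDl//; first by rewrite le_min !mulr_ge0 ?exprn_ge0// ltW.
      rewrite exprSr mulrA ler_wpM2r// mulrC ler_pdivlMr ?exprn_gt0//.
      by rewrite -exprMn mulrC; apply: lerXn2r; rewrite ?nnegrE ?mulr_ge0// ltW.
  rewrite ge0_integralD//; last first.
  - by apply/measurable_EFinP; exact: measurable_funM.
  - by move=> w _; rewrite lee_fin mulr_ge0 ?invr_ge0 ?exprn_ge0// ltW.
  apply: leeD => //.
  under eq_integral do rewrite EFinM.
  rewrite ge0_integralZl//; last 3 first.
  - exact/measurable_EFinP.
  - by move=> w _; rewrite lee_fin exprn_ge0.
  - by rewrite lee_fin invr_ge0 exprn_ge0// ltW.
  apply: (@le_trans _ _ ((C ^- p)%:E * S%:E)%E).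
    by apply: lee_wpmul2l => //; rewrite lee_fin invr_ge0 exprn_ge0// ltW.
  by rewrite -EFinM lee_fin mulrC.
apply: (@cvge_ge _ _ _ _ _ _ _ H).
by apply: cvgeD; [|exact: ff'|exact: cvg_cst]; rewrite fin_num_adde_defl.
Unshelve. all: by end_near. Qed.

Let mYe n : measurable_fun [set: T] (fun w => (Y n w ^+ p.+1)%:E).
Proof. exact/measurable_EFinP. Qed.

Let Y0e n w : (0 <= (Y n w ^+ p.+1)%:E)%E.
Proof. by rewrite lee_fin exprn_ge0. Qed.

Let Z0e w : (0 <= (Z w ^+ p.+1)%:E)%E.
Proof. by rewrite lee_fin exprn_ge0. Qed.

(** Weighted AM-GM gives (p+1) E Y_n^p Z <= E Z^(p+1) + p E Y_n^(p+1). By [weak_limit] the left side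
    is at least (p+1) E Y_n^(p+1), and the finite term p E Y_n^(p+1) cancels. *)
Lemma moment_le_limit n :
  (\int[P]_w (Y n w ^+ p.+1)%:E <= \int[P]_w (Z w ^+ p.+1)%:E)%E.
Proof.
have YZ0 w : (0 <= (Y n w ^+ p * Z w)%:E)%E.
  by rewrite lee_fin mulr_ge0 ?exprn_ge0.
have mYZ : measurable_fun [set: T] (EFin \o (fun w => Y n w ^+ p * Z w)).
  by apply/measurable_EFinP; exact: measurable_funM.
have mZX : measurable_fun [set: T] (EFin \o (fun w => Z w ^+ p.+1)).
  by apply/measurable_EFinP/measurable_funX.
have : (p.+1%:R%:E * \int[P]_w (Y n w ^+ p * Z w)%:E <=
   \int[P]_w (Z w ^+ p.+1)%:E + p%:R%:E * \int[P]_w (Y n w ^+ p.+1)%:E)%E.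
  rewrite -!ge0_integralZl//.
  rewrite -ge0_integralD//; last 2 first.
  - by move=> w _; rewrite mule_ge0.
  - exact: measurable_funeM.
  apply: ge0_le_integral => //.
  - by move=> w _; rewrite lee_fin !mulr_ge0 ?exprn_ge0.
  - exact: measurable_funeM.
  - by apply: emeasurable_funD => //; apply: measurable_funeM; apply/measurable_EFinP.
  - by move=> w _; rewrite -!EFinM -EFinD lee_fin exprM_weighted_AMGM.
have := weak_limit n.
move: (intY_fin n) intZ_fin.
case: (\int[P]_w (Y n w ^+ p.+1)%:E)%E => // y _.
case: (\int[P]_w (Z w ^+ p.+1)%:E)%E => // z _.
case: (\int[P]_w (Y n w ^+ p * Z w)%:E)%E => //= [u|_].
  rewrite -!EFinM -EFinD !lee_fin => yu.
  have : p.+1%:R * y <= p.+1%:R * u by rewrite ler_wpM2l.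
  rewrite -natr1; lra.
by rewrite gt0_muley ?lte_fin//.
Qed.

Lemma cvg_Lq_dist :
  (\int[P]_w (`|Y n w - Z w| ^+ p.+1)%:E @[n --> \oo] --> 0)%E.
Proof.
have mZX : measurable_fun [set: T] (EFin \o (fun w => Z w ^+ p.+1)).
  by apply/measurable_EFinP/measurable_funX.
pose f m w := (Num.min (Y m w) (Z w) ^+ p.+1)%:E.
have mf m : measurable_fun [set: T] (f m).
  by apply/measurable_EFinP; apply: measurable_funX; exact: measurable_minr.
have d0 n w : (0 <= (`|Y n w - Z w| ^+ p.+1)%:E)%E by rewrite lee_fin exprn_ge0.
have f0 m w : (0 <= f m w)%E by rewrite lee_fin exprn_ge0// le_min Y0 Z0.
have md n : measurable_fun [set: T] (fun w => (`|Y n w - Z w| ^+ p.+1)%:E).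
  apply/measurable_EFinP; apply: measurable_funX.
  by apply: measurableT_comp => //; exact: measurable_funB.
have fZ m w : (f m w <= (Z w ^+ p.+1)%:E)%E.
  by rewrite lee_fin lerXn2r ?nnegrE ?le_min ?Y0 ?Z0// ge_min lexx orbT.
have ff' : (\int[P]_w f m w @[m --> \oo] --> \int[P]_w (Z w ^+ p.+1)%:E)%E.
  have [] := @dominated_convergence _ _ _ P setT measurableT f
    (fun w => (Z w ^+ p.+1)%:E) (fun w => (Z w ^+ p.+1)%:E) mf => //.
  - apply: filterS cvgYZ => w YZ _.
    apply: cvg_EFin; first exact: nearW.
    apply: cvg_exprn; rewrite -{2}(minxx (Z w)).
    by apply: cvg_minr => //; exact: cvg_cst.
  - apply/integrableP; split => //.
    under eq_integral do rewrite gee0_abs ?lee_fin ?exprn_ge0//.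
    by rewrite -ge0_fin_numE ?intZ_fin//; apply: integral_ge0 => w _; rewrite lee_fin exprn_ge0.
  - by apply: aeW => w m _; rewrite gee0_abs.
set z := (\int[P]_w (Z w ^+ p.+1)%:E)%E in ff'.
have zfin : z \is a fin_num by exact: intZ_fin.
(* Integrate [expr_distD] and replace E Y_n^(p+1) by the larger E Z^(p+1): what remains is twice the
   defect of E min(Y_n, Z)^(p+1) from its limit. *)
have bound n : (\int[P]_w (`|Y n w - Z w| ^+ p.+1)%:E <=
    2%:E * (z - \int[P]_w f n w))%E.
  have ffin : (\int[P]_w f n w)%E \is a fin_num.
    rewrite ge0_fin_numE ?integral_ge0//.
    apply: (@le_lt_trans _ _ z); first exact: ge0_le_integral.
    by rewrite -ge0_fin_numE//; exact: integral_ge0.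
  have : (\int[P]_w (`|Y n w - Z w| ^+ p.+1)%:E + 2%:E * \int[P]_w f n w <=
     \int[P]_w (Y n w ^+ p.+1)%:E + z)%E.
    rewrite -ge0_integralZl// -!ge0_integralD//; last 2 first.
    - by move=> w _; rewrite mule_ge0.
    - exact: measurable_funeM.
    apply: ge0_le_integral => //.
    - by move=> w _; rewrite adde_ge0// ?mule_ge0// lee_fin exprn_ge0.
    - by apply: emeasurable_funD => //; exact: measurable_funeM.
    - by apply: emeasurable_funD => //; apply/measurable_EFinP.
    - by move=> w _; rewrite -EFinM -!EFinD lee_fin mulr_natl expr_distD.
  have := moment_le_limit n; rewrite -/z.
  move: (intY_fin n) zfin ffin {ff'}; move: z => z.
  case: (\int[P]_w (Y n w ^+ p.+1)%:E)%E => // y _; case: z => // z' _.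
  case: (\int[P]_w f n w)%E => // v _.
  case: (\int[P]_w (`|Y n w - Z w| ^+ p.+1)%:E)%E => [u| |].
  - rewrite -!EFinM -!EFinD !lee_fin; lra.
  - by [].
  - by move=> _ _; exact: leNye.
apply: (@squeeze_cvge _ _ _ _ (cst 0%E) _ (fun n => 2%:E * (z - \int[P]_w f n w))%E).
- by apply: nearW => n /=; rewrite bound andbT integral_ge0// => w _; rewrite lee_fin exprn_ge0.
- exact: cvg_cst.
- rewrite -[X in _ --> X](_ : 2%:E * (z - z) = 0)%E; last by rewrite subee// mule0.
  apply: cvgeZl => //; apply: cvgeB => //; last exact: cvg_cst.
  by rewrite fin_num_adde_defl// fin_numN.
Qed.

End Lq_convergence.

(** * Lower moments and convergence in probability *)

Lemma cvge_lt {R : realType} {I : Type} {F : set_system I} {FF : Filter F}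
    (u : I -> \bar R) (l c : \bar R) :
  u x @[x --> F] --> l -> (l < c)%E -> \forall x \near F, (u x < c)%E.
Proof.
move=> ul lc; apply: (ul [set y | (y < c)%E]).
by apply: open_nbhs_nbhs; split => //; exact: open_ereal_lt_ereal.
Qed.

Lemma cvge0P {R : realType} (u : nat -> \bar R) :
  (forall n, (0 <= u n)%E) ->
  (forall e : R, 0 < e -> \forall n \near \oo, (u n <= e%:E)%E) ->
  u n @[n --> \oo] --> 0%E.
Proof.
move=> u0 ue; apply/fine_cvgP; split.
  apply: filterS (ue 1 ltr01) => n un.
  by rewrite ge0_fin_numE//; exact: le_lt_trans un (ltry _).
apply/cvgr0Pnorm_le => e e0; apply: filterS (ue e e0) => n un.
have ufin : u n \is a fin_num.
  by rewrite ge0_fin_numE//; exact: le_lt_trans un (ltry _).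
by rewrite /= ger0_norm ?fine_ge0// -lee_fin fineK.
Qed.

(** Split at s = e^(1/p). Below s, x^p <= s^p = e; above s, x^p = x^(p-q) x^q <= s^(p-q) x^q because
    p <= q. Integrated, this controls the p-th moment by the q-th up to an arbitrarily small
    error. *)
Lemma powR_le_eps_exprn {R : realType} (p e : R) (q : nat) :
  0 < p -> p <= q%:R -> 0 < e ->
  exists2 K, 0 < K & forall x : R, 0 <= x -> x `^ p <= e + K * x ^+ q.
Proof.
move=> p0 pq e0; pose s := e `^ p^-1.
have s0 : 0 < s by exact: powR_gt0.
have sp : s `^ p = e by rewrite -powRrM mulVf ?gt_eqF// powRr1// ltW.
exists (s `^ (p - q%:R)); first exact: powR_gt0.
move=> x x0; have [xs|sx] := leP x s.
  apply: (@le_trans _ _ e); last by rewrite lerDl mulr_ge0 ?powR_ge0 ?exprn_ge0.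
  by rewrite -sp ge0_ler_powR ?nnegrE// ltW.
have xgt0 : 0 < x by exact: lt_trans sx.
rewrite ler_wpDl ?(ltW e0)// -powR_mulrn//.
rewrite -[p in x `^ p](subrK q%:R) [x `^ _]powRD ?subrK ?(gt_eqF p0)//.
apply: ler_wpM2r; first exact: powR_ge0.
rewrite -(opprB q%:R p) !powRN lef_pV2 ?posrE ?powR_gt0//.
by rewrite ge0_ler_powR ?nnegrE ?subr_ge0// ltW.
Qed.

Section lower_moments.
Context {d : measure_display} {T : measurableType d} {R : realType}.
Variables (P : probability T R) (D : nat -> T -> R) (q : nat).
Hypothesis mD : forall n, measurable_fun [set: T] (D n).
Hypothesis D0 : forall n w, 0 <= D n w.
Hypothesis Dq : (\int[P]_w (D n w ^+ q)%:E @[n --> \oo] --> 0)%E.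

Let mDq n (K : R) : measurable_fun [set: T] (fun w => (K * D n w ^+ q)%:E).
Proof. by apply/measurable_EFinP/measurable_funM => //; exact: measurable_funX. Qed.

Let D0q n w : (0 <= (D n w ^+ q)%:E)%E.
Proof. by rewrite lee_fin exprn_ge0. Qed.

Let near_small (K e : R) : 0 < K -> 0 < e ->
  \forall n \near \oo, (\int[P]_w (K * D n w ^+ q)%:E <= e%:E)%E.
Proof.
move=> K0 e0; have eK : (0 < (e / K)%:E)%E by rewrite lte_fin divr_gt0.
apply: filterS (cvge_lt Dq eK) => n /ltW h.
under eq_integral do rewrite EFinM.
rewrite ge0_integralZl//; last 2 first.
- by apply/measurable_EFinP/measurable_funX.
- by rewrite lee_fin ltW.
have -> : e = K * (e / K) by rewrite mulrC divfK// gt_eqF.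
by rewrite [leRHS]EFinM; apply: lee_wpmul2l => //; rewrite lee_fin ltW.
Qed.

Lemma cvg_lower_moment (p : R) : 0 < p -> p <= q%:R ->
  (\int[P]_w (D n w `^ p)%:E @[n --> \oo] --> 0)%E.
Proof.
move=> p0 pq; apply: cvge0P => [n|e e0].
  by apply: integral_ge0 => w _; rewrite lee_fin powR_ge0.
have e20 : 0 < e / 2 by rewrite divr_gt0.
have [K K0 HK] := powR_le_eps_exprn p0 pq e20.
apply: filterS (near_small K0 e20) => n h.
apply: (@le_trans _ _ (\int[P]_w ((e / 2)%:E + (K * D n w ^+ q)%:E))%E).
  apply: ge0_le_integral => //.
  - by move=> w _; rewrite lee_fin powR_ge0.
  - apply/measurable_EFinP.
    by apply: (measurableT_comp (measurable_powR p)).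
  - exact: emeasurable_funD.
  - by move=> w _; rewrite -EFinD lee_fin HK.
rewrite ge0_integralD//; last 2 first.
- by move=> w _; rewrite lee_fin ltW.
- by move=> w _; rewrite lee_fin mulr_ge0 ?exprn_ge0// ltW.
rewrite integral_cst//= probability_setT mule1.
by rewrite [in leRHS](splitr e) EFinD leeD2l.
Qed.

Lemma cvg_in_probability (e : R) : 0 < e ->
  P [set w | e <= D n w] @[n --> \oo] --> 0%E.
Proof.
move=> e0; apply: cvge0P => // c c0.
(* Markov's inequality: the indicator of [e <= D n w] is at most [e ^- q * D n w ^+ q]. *)
have K0 : 0 < e ^- q by rewrite invr_gt0 exprn_gt0.
apply: filterS (near_small K0 c0) => n; apply: le_trans.
have mE : measurable [set w | e <= D n w].
  rewrite -[X in measurable X]setTI.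
  by apply: (@measurable_fun_ler _ _ _ setT (cst e) (D n)) => //.
rewrite -(setIT [set w | e <= D n w]) -integral_indic//.
apply: ge0_le_integral => //.
- by apply/measurable_EFinP; exact: measurable_indic.
- move=> w _; rewrite lee_fin indicE; case: (boolP (_ \in _)) => [|_].
    rewrite inE/= => eD; rewrite mulrC ler_pdivlMr ?exprn_gt0// mul1r.
    by apply: lerXn2r; rewrite ?nnegrE// ltW.
  by rewrite mulr_ge0 ?exprn_ge0// ltW.
Qed.

End lower_moments.
(** * Integrals over ordered times *)

Local Notation MR R := (measurableTypeR R).

Lemma measurable_expe {d : measure_display} {T : measurableType d} {R : realType}
    (h : T -> \bar R) (k : nat) :
  measurable_fun [set: T] h -> measurable_fun [set: T] (fun w => (h w ^+ k)%E).
Proof.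
move=> mh; elim: k => [|k IH]; first exact: measurable_cst.
by under eq_fun do rewrite expeS; exact: emeasurable_funM.
Qed.

Lemma integral_itv_if {R : realType} (s t : R) (g : MR R -> \bar R) :
  (\int[lebesgue_measure]_(v in `[s, t]) g v =
   \int[lebesgue_measure]_v (if (s <= v <= t)%R then g v else 0))%E.
Proof.
rewrite integral_mkcond; apply: eq_integral => v _.
by rewrite patchE mem_setE in_itv.
Qed.

Section tonelli_interval.
Context {d : measure_display} {T : measurableType d} {R : realType}.

(** The variable end points are absorbed into the integrand as an indicator, which reduces the claim
    to the measurability part of Tonelli's theorem. *)
Lemma measurable_integral_itv (g : MR R * T -> \bar R) (a b : T -> R) :
  measurable_fun [set: MR R * T] g -> (forall z, 0 <= g z)%E ->
  measurable_fun [set: T] a -> measurable_fun [set: T] b ->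
  measurable_fun [set: T]
    (fun w => \int[lebesgue_measure]_(v in `[a w, b w]) g (v, w))%E.
Proof.
move=> mg g0 ma mb.
pose h (y : T * MR R) : \bar R :=
  if a y.1 <= y.2 <= b y.1 then g (y.2, y.1) else 0%E.
have mh : measurable_fun [set: T * MR R] h.
  apply: measurable_fun_ifT => //.
    by apply: measurable_and; apply: measurable_fun_ler => //;
      apply: measurableT_comp.
  by apply: (measurableT_comp mg); apply: measurable_fun_pair.
have h0 y : (0 <= h y)%E by rewrite /h; case: ifP.
have := measurable_fun_fubini_tonelli_F (m2 := lebesgue_measure) h mh h0.
by congr (measurable_fun _ _); apply/funext => z; rewrite integral_itv_if.
Qed.

Lemma tonelli_itv (P : probability T R) (g : MR R * T -> \bar R) (s t : R) :
  measurable_fun [set: MR R * T] g -> (forall z, 0 <= g z)%E ->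
  (\int[P]_w \int[lebesgue_measure]_(v in `[s, t]) g (v, w) =
   \int[lebesgue_measure]_(v in `[s, t]) \int[P]_w g (v, w))%E.
Proof.
move=> mg g0.
pose h (y : T * MR R) : \bar R := if s <= y.2 <= t then g (y.2, y.1) else 0%E.
have mh : measurable_fun [set: T * MR R] h.
  apply: measurable_fun_ifT => //.
    by apply: measurable_and; apply: measurable_fun_ler.
  by apply: (measurableT_comp mg); apply: measurable_fun_pair.
have h0 y : (0 <= h y)%E by rewrite /h; case: ifP.
have := fubini_tonelli (m1 := P) (m2 := lebesgue_measure) h mh h0.
rewrite integral_itv_if; under eq_integral do rewrite -integral_itv_if.
move=> ->; apply: eq_integral => v _; rewrite /h/=.
by case: ifP => // _; rewrite integral0.
Qed.

End tonelli_interval.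

Section ordered_powers.
Context {R : realType}.
Variables (h : MR R -> \bar R) (t : R).
Hypothesis mh : measurable_fun [set: MR R] h.
Hypothesis h0 : forall v, (0 <= h v)%E.

Let H s := (\int[lebesgue_measure]_(v in `[s, t]) h v)%E.

Let mH1 : measurable_fun [set: MR R * MR R] (fun z => h z.1).
Proof. exact: measurableT_comp. Qed.

Let mH : measurable_fun [set: MR R] H.
Proof. exact: (measurable_integral_itv mH1 (fun z => h0 z.1)). Qed.

Let mH' s : measurable_fun [set: MR R]
  (fun v : MR R => \int[lebesgue_measure]_(r in `[s, v]) h r)%E.
Proof. exact: (measurable_integral_itv mH1 (fun z => h0 z.1)). Qed.

Let H0 s : (0 <= H s)%E. Proof. exact: integral_ge0. Qed.

Lemma tonelli_triangle (a : MR R -> \bar R) (s : R) :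
  measurable_fun [set: MR R] a -> (forall v, 0 <= a v)%E ->
  (\int[lebesgue_measure]_(v in `[s, t])
     (a v * \int[lebesgue_measure]_(r in `[s, v]) h r) =
   \int[lebesgue_measure]_(r in `[s, t])
     (h r * \int[lebesgue_measure]_(v in `[r, t]) a v))%E.
Proof.
move=> ma a0.
(* Both sides integrate [a v * h r] over the triangle s <= r <= v <= t, in the two orders. *)
pose g (y : MR R * MR R) : \bar R :=
  if (s <= y.2 <= y.1) && (y.1 <= t) then (a y.1 * h y.2)%E else 0%E.
have mg : measurable_fun [set: MR R * MR R] g.
  apply: measurable_fun_ifT => //.
    by apply: measurable_and; [apply: measurable_and|]; apply: measurable_fun_ler.
  by apply: emeasurable_funM; apply: measurableT_comp.
have g0 y : (0 <= g y)%E by rewrite /g; case: ifP => // _; rewrite mule_ge0.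
have := fubini_tonelli (m1 := lebesgue_measure) (m2 := lebesgue_measure) g mg g0.
have E1 v : (\int[lebesgue_measure]_r g (v, r) = if (s <= v <= t)%R
    then a v * \int[lebesgue_measure]_(r in `[s, v]) h r else 0)%E.
  case: ifP => [/andP[sv vt]|nsvt].
    rewrite -ge0_integralZl//; last exact: measurable_funTS.
    rewrite integral_itv_if; apply: eq_integral => r _.
    by rewrite /g/= vt andbT.
  under eq_integral do rewrite /g/=.
  apply: integral0_eq => r _; case: ifP => // /andP[/andP[sr rv] vt].
  by move: nsvt; rewrite (le_trans sr rv) vt.
have E2 r : (\int[lebesgue_measure]_v g (v, r) = if (s <= r <= t)%R
    then h r * \int[lebesgue_measure]_(v in `[r, t]) a v else 0)%E.
  case: ifP => [/andP[sv vt]|nsvt].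
    rewrite -ge0_integralZl//; last exact: measurable_funTS.
    rewrite integral_itv_if; apply: eq_integral => v _.
    by rewrite /g/= sv/= muleC.
  under eq_integral do rewrite /g/=.
  apply: integral0_eq => v _; case: ifP => // /andP[/andP[sr rv] vt].
  by move: nsvt; rewrite sr (le_trans rv vt).
under eq_integral do rewrite E1; under [in RHS]eq_integral do rewrite E2.
by rewrite -!integral_itv_if.
Qed.

Lemma integral_itv_split (s v : R) : s <= v -> v <= t ->
  (H s = \int[lebesgue_measure]_(r in `[s, v]) h r + H v)%E.
Proof.
(* The second interval is opened at [v] to make the two pieces disjoint. *)
move=> sv vt; rewrite /H -[X in (_ + X)%E]integral_itv_obnd_cbnd; last first.
  exact: measurable_funTS.
rewrite -ge0_integral_setU//=.
- congr (integral _ _ _); apply/seteqP; split => r; rewrite /= !in_itv/=.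
    by move=> /andP[sr rt]; case: (leP r v) => rv; [left|right]; rewrite ?sr ?rv.
  move=> [] /andP[? ?]; apply/andP; split => //.
    by apply: le_trans vt.
  by apply: (le_trans sv); apply: ltW.
- exact: measurable_funTS.
- apply/disj_setPS => r [] /=; rewrite !in_itv/= => /andP[_ rv] /andP[vr _].
  by move: rv; rewrite leNgt vr.
Qed.

(* [H ^+ k.+1 = k.+1 \int h H ^+ k] is the expansion of [H ^+ k.+1] over ordered
   times, one time at a stage; it also holds where [H] is infinite. *)
Lemma integral_itv_exp (s : R) (k : nat) :
  (H s ^+ k.+1 =
   k.+1%:R%:E * \int[lebesgue_measure]_(v in `[s, t]) (h v * H v ^+ k))%E.
Proof.
have mHk k' : measurable_fun [set: MR R] (fun v => h v * H v ^+ k')%E.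
  by apply: emeasurable_funM => //; exact: measurable_expe.
have Hk0 k' v : (0 <= h v * H v ^+ k')%E by rewrite mule_ge0// expe_ge0.
elim: k s => [|k IH] s.
  rewrite mul1e; apply: eq_integral => v _.
  by rewrite expe0 mule1.
rewrite expeS IH muleCA.
(* [H s] is split at [v]. The piece over [s, v], exchanged over the triangle, gives one copy of the
   integral of [h * H ^+ k.+1] by the induction hypothesis; the piece [H v] gives [k.+1] further
   copies. *)
have -> : (H s * \int[lebesgue_measure]_(v in `[s, t]) (h v * H v ^+ k) =
  \int[lebesgue_measure]_(v in `[s, t]) (h v * H v ^+ k * \int[lebesgue_measure]_(r in `[s, v]) h r)
  + \int[lebesgue_measure]_(v in `[s, t]) (h v * H v ^+ k.+1))%E.
  rewrite -ge0_integralZl//; last exact: measurable_funTS.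
  rewrite -ge0_integralD//.
  - apply: eq_integral => v vst.
    have [sv vt] : s <= v /\ v <= t by apply/andP; move: vst; rewrite inE/= in_itv.
    rewrite (integral_itv_split sv vt) ge0_muleDl//; last exact: integral_ge0.
    by rewrite muleC expeS; congr (_ + _)%E; rewrite muleCA.
  - by move=> v _; rewrite mule_ge0//; exact: integral_ge0.
  - apply: measurable_funTS; exact: emeasurable_funM.
  - exact: measurable_funTS.
rewrite tonelli_triangle//.
rewrite ge0_muleDr ?integral_ge0//; last first.
  by move=> v _; rewrite mule_ge0// integral_ge0.
rewrite -ge0_integralZl//; last 2 first.
- apply: measurable_funTS; apply: emeasurable_funM => //.
  have mG : measurable_fun [set: MR R * MR R] (fun z => h z.1 * H z.1 ^+ k)%E.
    exact: (measurableT_comp (mHk k)).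
  exact: (measurable_integral_itv mG (fun z => Hk0 k z.1)).
- by move=> v _; rewrite mule_ge0// integral_ge0.
under eq_integral do rewrite muleCA -IH.
by rewrite -[in RHS]natr1 EFinD ge0_muleDl ?mul1e 1?addeC.
Qed.

End ordered_powers.

(** * Moments of the integral of a random process *)

Section iterated_moments.
Context {d : measure_display} {T : measurableType d} {R : realType}.
Variable P : probability T R.

Lemma tonelli_weighted (G : T -> \bar R) (h : MR R * T -> \bar R) (s t : R) :
  measurable_fun [set: T] G -> (forall w, 0 <= G w)%E ->
  measurable_fun [set: MR R * T] h -> (forall z, 0 <= h z)%E ->
  (\int[P]_w (G w * \int[lebesgue_measure]_(v in `[s, t]) h (v, w)) =
   \int[lebesgue_measure]_(v in `[s, t]) \int[P]_w (G w * h (v, w)))%E.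
Proof.
move=> mG G0 mh h0; rewrite -(tonelli_itv P s t (g := fun z => G z.2 * h z)%E).
- apply: eq_integral => w _; rewrite -ge0_integralZl//.
  by apply: measurable_funTS; exact: (measurable_fun_pair1 w mh).
- by apply: emeasurable_funM => //; exact: measurableT_comp.
- by move=> z; rewrite mule_ge0.
Qed.

Lemma measurable_joint_prod (f : R -> T -> R) (l : seq R) :
  measurable_fun [set: MR R * T] (fun z => f z.1 z.2) ->
  measurable_fun [set: T] (fun w => (\prod_(r <- l) f r w)%:E).
Proof.
move=> mf; apply/measurable_EFinP; elim: l => [|r l IH].
  by under eq_fun do rewrite big_nil; exact: measurable_cst.
under eq_fun do rewrite big_cons.
by apply: measurable_funM => //; exact: (measurable_fun_pair2 (r : MR R) mf).
Qed.

Variable t : R.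

(** The value is kept in [0, +oo], so that powers can be expanded before finiteness is known. The
    lower end [s] varies because the expansion removes the earliest time first. *)
Definition cumul (f : R -> T -> R) (s : R) (w : T) : \bar R :=
  (\int[lebesgue_measure]_(v in `[s, t]) (f v w)%:E)%E.

Lemma cumul_ge0 (f : R -> T -> R) s w : (forall s w, 0 <= f s w) ->
  (0 <= cumul f s w)%E.
Proof. by move=> f0; apply: integral_ge0 => v _; rewrite lee_fin. Qed.

Lemma measurable_cumul (f : R -> T -> R) :
  measurable_fun [set: MR R * T] (fun z => f z.1 z.2) ->
  (forall s w, 0 <= f s w) ->
  measurable_fun [set: MR R * T] (fun z => cumul f z.1 z.2).
Proof.
move=> mf f0.
have mg : measurable_fun [set: MR R * (MR R * T)] (fun z => (f z.1 z.2.2)%:E).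
  apply/measurable_EFinP.
  apply: (measurableT_comp (f := fun z : MR R * T => f z.1 z.2)
    (g := fun z : MR R * (MR R * T) => (z.1, z.2.2))) => //.
  by apply: measurable_fun_pair => //; apply: measurableT_comp.
apply: (measurable_integral_itv mg) => //.
by move=> z; rewrite lee_fin.
Qed.

Section expansion.
Variables (f : R -> T -> R) (G : T -> \bar R).
Hypothesis mf : measurable_fun [set: MR R * T] (fun z => f z.1 z.2).
Hypothesis f0 : forall s w, 0 <= f s w.
Hypothesis mG : measurable_fun [set: T] G.
Hypothesis G0 : forall w, (0 <= G w)%E.

Let Mh k : measurable_fun [set: MR R * T]
  (fun z => (f z.1 z.2)%:E * cumul f z.1 z.2 ^+ k)%E.
Proof.
apply: emeasurable_funM; first exact/measurable_EFinP.
by apply: measurable_expe; exact: measurable_cumul.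
Qed.

Let h0 k (z : MR R * T) : (0 <= (f z.1 z.2)%:E * cumul f z.1 z.2 ^+ k)%E.
Proof. by rewrite mule_ge0 ?lee_fin// expe_ge0// cumul_ge0. Qed.

Lemma measurable_expansion k : measurable_fun [set: MR R]
  (fun v => \int[P]_w (G w * ((f v w)%:E * cumul f v w ^+ k)))%E.
Proof.
apply: (measurable_fun_fubini_tonelli_F (m2 := P)
  (fun z : MR R * T => G z.2 * ((f z.1 z.2)%:E * cumul f z.1 z.2 ^+ k))%E).
- by apply: emeasurable_funM => //; exact: measurableT_comp.
- by move=> z; rewrite mule_ge0.
Qed.

(** One stage of the expansion under the expectation; the weight [G] carries the factors at the
    times already chosen. *)
Lemma cumul_exp_expansion s k :
  (\int[P]_w (G w * cumul f s w ^+ k.+1) = k.+1%:R%:E *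
   \int[lebesgue_measure]_(v in `[s, t])
     \int[P]_w (G w * ((f v w)%:E * cumul f v w ^+ k)))%E.
Proof.
have E w : (cumul f s w ^+ k.+1 = k.+1%:R%:E *
    \int[lebesgue_measure]_(v in `[s, t]) ((f v w)%:E * cumul f v w ^+ k))%E.
  apply: integral_itv_exp; last by move=> v; rewrite lee_fin.
  by apply/measurable_EFinP; exact: (measurable_fun_pair1 w mf).
under eq_integral do rewrite E muleCA.
rewrite ge0_integralZl//; last 2 first.
- apply: emeasurable_funM => //.
  exact: (measurable_integral_itv (a := cst s) (b := cst t) (Mh k) (h0 k)).
- move=> w _; rewrite mule_ge0//; apply: integral_ge0 => v _.
  exact: (h0 k (v, w)).
by congr (_ * _)%E; exact: (tonelli_weighted s t mG G0 (Mh k) (h0 k)).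
Qed.

End expansion.

Definition ordered_times (s0 : R) (l : seq R) : bool :=
  [&& 0 <= s0, path <=%R s0 l & last s0 l <= t].

(** The [p.+1] ordered times are chosen one by one. Each of the [p] gaps integrates to at most [C],
    the first time contributes the length [t], and the successive stages produce the factorial. *)
Lemma iterated_moment_bound (f : R -> T -> R) (g : R -> R) (p : nat) (K C : R) :
  measurable_fun [set: MR R * T] (fun z => f z.1 z.2) ->
  (forall s w, 0 <= f s w) ->
  measurable_fun [set: MR R] g -> (forall u, 0 <= g u) -> 0 <= K -> 0 <= C ->
  0 <= t ->
  (forall s, (0 <= s)%R -> (s <= t)%R ->
    \int[lebesgue_measure]_(v in `[s, t]) (g (v - s))%:E <= C%:E)%E ->
  (forall s0 l, size l = p -> ordered_times s0 l ->
    \int[P]_w (\prod_(r <- s0 :: l) f r w)%:E <=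
    (K * \prod_(x <- pairmap (fun a b => g (b - a)) s0 l) x)%:E)%E ->
  (\int[P]_w (cumul f 0 w ^+ p.+1) <= (p.+1`!%:R * (K * C ^+ p) * t)%:E)%E.
Proof.
move=> mf f0 mg g0 K0 C0 t0 gC fK.
have F0 s w k : (0 <= cumul f s w ^+ k)%E by rewrite expe_ge0// cumul_ge0.
have G0 l w : (0 <= (\prod_(r <- l) f r w)%:E)%E.
  by rewrite lee_fin; apply: prodr_ge0 => r _.
have mG l := measurable_joint_prod l mf.
(* [k] counts the times still hidden in the power of [cumul]. At [k = 0] all [p.+1] times are fixed
   and [fK] applies. *)
have bound k s0 l : (size l + k = p)%N -> ordered_times s0 l ->
    (\int[P]_w ((\prod_(r <- s0 :: l) f r w)%:E * cumul f (last s0 l) w ^+ k) <=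
     (k`!%:R * (K * \prod_(x <- pairmap (fun a b => g (b - a)) s0 l) x * C ^+ k))%:E)%E.
  elim: k s0 l => [|k IH] s0 l slk tl.
    under eq_integral do rewrite expe0 mule1.
    by rewrite fact0 mul1r expr0 mulr1 fK// -slk addn0.
  set D := \prod_(x <- pairmap _ _ _) x.
  have D0 : 0 <= D.
    rewrite /D; elim: (l) (s0) => [|r l' IHl] s1 /=; first by rewrite big_nil.
    by rewrite big_cons mulr_ge0.
  have /and3P[s00 pl lt] := tl.
  have l0 : 0 <= last s0 l.
    elim: (l) (s0) s00 pl => //= r l' IHl s1 s10 /andP[s1r pl'].
    by apply: IHl => //; exact: le_trans s1r.
  have M0 : 0 <= k`!%:R * (K * D * C ^+ k) by rewrite !mulr_ge0// exprn_ge0.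
  have mgl : measurable_fun [set: MR R] (fun v => (g (v - last s0 l))%:E).
    apply/measurable_EFinP; apply: (measurableT_comp mg).
    exact: (measurable_funB (@measurable_id _ (MR R) setT) (measurable_cst _)).
  rewrite cumul_exp_expansion//.
  apply: (@le_trans _ _ (k.+1%:R%:E * \int[lebesgue_measure]_(v in `[last s0 l, t])
      ((k`!%:R * (K * D * C ^+ k))%:E * (g (v - last s0 l))%:E))%E).
    apply: lee_wpmul2l; first by rewrite lee_fin.
    apply: ge0_le_integral => //.
    - by move=> v _; apply: integral_ge0 => w _; rewrite !mule_ge0// lee_fin.
    - by apply: measurable_funTS; exact: measurable_expansion.
    - by apply: measurable_funTS; exact: measurable_funeM.
    - move=> v; rewrite /= in_itv/= => /andP[lv vt].
      have := IH s0 (rcons l v); rewrite size_rcons addSnnS slk last_rcons.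
      rewrite /ordered_times rcons_path last_rcons s00 pl lv vt => /(_ erefl isT).
      under eq_integral do rewrite -rcons_cons big_rcons/= EFinM -muleA.
      move=> /le_trans; apply; rewrite -EFinM lee_fin.
      rewrite -cats1 pairmap_cat/= big_cat big_seq1/= -/D.
      by rewrite le_eqVlt; apply/orP; left; apply/eqP; ring.
  rewrite ge0_integralZl//; last 2 first.
  - exact: measurable_funTS.
  - by move=> v _; rewrite lee_fin.
  apply: (@le_trans _ _ (k.+1%:R%:E * ((k`!%:R * (K * D * C ^+ k))%:E * C%:E))%E).
    apply: lee_wpmul2l; first by rewrite lee_fin.
    by apply: lee_wpmul2l; rewrite ?lee_fin//; exact: gC.
  rewrite -!EFinM lee_fin factS natrM exprS.
  by rewrite le_eqVlt; apply/orP; left; apply/eqP; ring.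
have E : (\int[P]_w (cumul f 0 w ^+ p.+1) =
    \int[P]_w ((\prod_(r <- [::]) f r w)%:E * cumul f 0 w ^+ p.+1))%E.
  by apply: eq_integral => w _; rewrite big_nil mul1e.
(* The first time has no predecessor: it is integrated against a constant over [0, t], which yields
   the factor [t]. *)
rewrite E cumul_exp_expansion//.
apply: (@le_trans _ _ (p.+1%:R%:E * \int[lebesgue_measure]_(v in `[0%R, t])
    (p`!%:R * (K * C ^+ p))%:E)%E).
  apply: lee_wpmul2l; first by rewrite lee_fin.
  apply: ge0_le_integral => //.
  - by move=> v _; apply: integral_ge0 => w _; rewrite !mule_ge0// lee_fin.
  - by apply: measurable_funTS; exact: measurable_expansion.
  - move=> v; rewrite /= in_itv/= => /andP[lv vt].
    have := bound p v [::] erefl; rewrite /ordered_times/= lv vt => /(_ isT).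
    rewrite big_nil mulr1; apply: le_trans.
    rewrite le_eqVlt; apply/orP; left; apply/eqP; apply: eq_integral => w _.
    by rewrite big_nil mul1e big_seq1.
rewrite integral_cst//= lebesgue_measure_itv/= lte_fin.
have -> : (if 0 < t then (t%:E - 0%:E)%E else 0%E) = t%:E.
  by case: ltP => [_|t0']; [rewrite sube0|congr EFin; apply/eqP; rewrite eq_le t0 t0'].
rewrite -!EFinM lee_fin factS natrM.
by rewrite le_eqVlt; apply/orP; left; apply/eqP; ring.
Qed.

(** Both sides are integrals over a cube of times, unordered this time, and the hypothesis equates
    the integrands at every choice of times. *)
Lemma cumul_martingale (f1 f2 : R -> T -> R) (k : nat) :
  measurable_fun [set: MR R * T] (fun z => f1 z.1 z.2) ->
  measurable_fun [set: MR R * T] (fun z => f2 z.1 z.2) ->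
  (forall s w, 0 <= f1 s w) -> (forall s w, 0 <= f2 s w) ->
  (forall l s, \int[P]_w (\prod_(r <- l) f1 r w * f2 s w)%:E =
               \int[P]_w (\prod_(r <- l) f1 r w * f1 s w)%:E)%E ->
  (\int[P]_w (cumul f1 0 w ^+ k * cumul f2 0 w) =
   \int[P]_w (cumul f1 0 w ^+ k.+1))%E.
Proof.
move=> mf1 mf2 f10 f20 H.
have F0 w i : (0 <= cumul f1 0 w ^+ i)%E by rewrite expe_ge0// cumul_ge0.
have mF i : measurable_fun [set: T] (fun w => cumul f1 0 w ^+ i)%E.
  apply: measurable_expe.
  exact: (measurable_fun_pair2 (0 : MR R) (measurable_cumul mf1 f10)).
have G0 l (f : R -> T -> R) s w : (forall s w, 0 <= f s w) ->
    (0 <= (\prod_(r <- l) f1 r w * f s w)%:E)%E.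
  by move=> f0; rewrite lee_fin mulr_ge0//; apply: prodr_ge0 => r _.
have mG l (f : R -> T -> R) (s : R) : measurable_fun [set: MR R * T] (fun z => f z.1 z.2) ->
    measurable_fun [set: T] (fun w => (\prod_(r <- l) f1 r w * f s w)%:E).
  move=> mf; apply/measurable_EFinP; apply: measurable_funM.
    by apply/measurable_EFinP; exact: measurable_joint_prod.
  exact: (measurable_fun_pair2 (s : MR R) mf).
(* The factors of [cumul f1 0 w ^+ i] are opened one at a time and their times are moved into the
   list [l]. *)
have key i l s : (\int[P]_w ((\prod_(r <- l) f1 r w * f2 s w)%:E * cumul f1 0 w ^+ i) =
    \int[P]_w ((\prod_(r <- l) f1 r w * f1 s w)%:E * cumul f1 0 w ^+ i))%E.
  elim: i l => [|i IH] l.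
    under eq_integral do rewrite expe0 mule1.
    under [RHS]eq_integral do rewrite expe0 mule1.
    exact: H.
  have E (f : R -> T -> R) : (forall s w, 0 <= f s w) ->
    measurable_fun [set: MR R * T] (fun z => f z.1 z.2) ->
    (\int[P]_w ((\prod_(r <- l) f1 r w * f s w)%:E * cumul f1 0 w ^+ i.+1) =
     \int[lebesgue_measure]_(v in `[0%R, t])
     \int[P]_w ((\prod_(r <- v :: l) f1 r w * f s w)%:E * cumul f1 0 w ^+ i))%E.
    move=> f0 mf; have := @tonelli_weighted
      (fun w => (\prod_(r <- l) f1 r w * f s w)%:E * cumul f1 0 w ^+ i)%E
      (fun z => (f1 z.1 z.2)%:E) 0 t.
    move=> E; etransitivity; last (etransitivity; first apply: E).
    - by apply: eq_integral => w _; rewrite expeS [X in (_ * X)%E]muleC muleA.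
    - by apply: emeasurable_funM => //; exact: mG.
    - by move=> w; rewrite mule_ge0// G0.
    - exact/measurable_EFinP.
    - by move=> z; rewrite lee_fin.
    - apply: eq_integral => v _; apply: eq_integral => w _ /=.
      by rewrite big_cons -muleA [X in (_ * X)%E]muleC muleA -EFinM; congr (EFin _ * _)%E; ring.
  etransitivity; first exact: (E f2 f20 mf2).
  etransitivity; last exact: esym (E f1 f10 mf1).
  by apply: eq_integral => v _; exact: IH (v :: l).
have F (f : R -> T -> R) : (forall s w, 0 <= f s w) ->
    measurable_fun [set: MR R * T] (fun z => f z.1 z.2) ->
    (\int[P]_w (cumul f1 0 w ^+ k * cumul f 0 w) =
     \int[lebesgue_measure]_(v in `[0%R, t])
       \int[P]_w ((\prod_(r <- [::]) f1 r w * f v w)%:E * cumul f1 0 w ^+ k))%E.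
  move=> f0 mf; have := @tonelli_weighted
    (fun w => cumul f1 0 w ^+ k)%E (fun z => (f z.1 z.2)%:E) 0 t.
  move=> E; etransitivity; first apply: E => //.
  - exact/measurable_EFinP.
  - by move=> z; rewrite lee_fin.
  - apply: eq_integral => v _; apply: eq_integral => w _ /=.
    by rewrite big_nil mul1r muleC.
rewrite F//; under eq_integral do rewrite key.
by rewrite -F//; apply: eq_integral => w _; rewrite expeS muleC.
Qed.

End iterated_moments.
(** * Independence and stationarity *)

Section independence.
Context {d : measure_display} {T : measurableType d} {R : realType}.
Variable P : probability T R.

(** The layer-cake integrand: for [Y w >= 0], its Lebesgue integral over [r] is [Y w]. *)
Let level (Y : T -> R) (r : R) (w : T) : \bar R :=
  if (0 <= r)%R && (r < Y w)%R then 1%E else 0%E.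

Let level_ge0 Y r w : (0 <= level Y r w)%E.
Proof. by rewrite /level; case: ifP. Qed.

Let measurable_level (Y : T -> R) : measurable_fun [set: T] Y ->
  measurable_fun [set: T * MR R] (fun z => level Y z.2 z.1).
Proof.
move=> mY; apply: measurable_fun_ifT => //.
apply: measurable_and; first exact: measurable_fun_ler.
by apply: measurable_fun_ltr => //; exact: measurableT_comp.
Qed.

Lemma layer_cake (W : T -> \bar R) (Y : T -> R) :
  measurable_fun [set: T] W -> (forall w, 0 <= W w)%E ->
  measurable_fun [set: T] Y -> (forall w, 0 <= Y w)%R ->
  (\int[P]_w (W w * (Y w)%:E) =
   \int[lebesgue_measure]_(r in [set: MR R]) \int[P]_w (W w * level Y r w))%E.
Proof.
move=> mW W0 mY Y0; have mL := measurable_level mY.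
rewrite -(fubini_tonelli (m1 := P) (m2 := lebesgue_measure)
  (fun z : T * MR R => W z.1 * level Y z.2 z.1)%E); last 2 first.
- by apply: emeasurable_funM => //; exact: measurableT_comp.
- by move=> z; rewrite mule_ge0.
apply: eq_integral => w _ /=; rewrite ge0_integralZl//; last first.
  exact: (measurable_fun_pair2 w mL).
congr (_ * _)%E.
transitivity (\int[lebesgue_measure]_(r in [set: MR R]) (\1_`[0, Y w[ r)%:E)%E.
  rewrite integral_indic// setIT.
  have := lebesgue_measure_itv `[0, Y w[; rewrite /= lte_fin sube0 => ->.
  by case: ltP => // Yw; congr EFin; apply/eqP; rewrite eq_le Yw Y0.
apply: eq_integral => r _; rewrite indicE /level mem_setE in_itv/=.
by case: ifP.
Qed.

(** By the layer-cake formula, a product rule known for every superlevel set of [Y] extends to [Y].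
    In the application [c] is the expectation of [W], already in factored form. *)
Lemma integral_prod_level (W : T -> \bar R) (Y : T -> R) (c : \bar R) :
  measurable_fun [set: T] W -> (forall w, 0 <= W w)%E ->
  measurable_fun [set: T] Y -> (forall w, 0 <= Y w)%R -> (0 <= c)%E ->
  (forall r, (0 <= r)%R -> \int[P]_w (W w * (\1_[set w | (r < Y w)%R] w)%:E) =
    c * P [set w | (r < Y w)%R])%E ->
  (\int[P]_w (W w * (Y w)%:E) = c * \int[P]_w (Y w)%:E)%E.
Proof.
move=> mW W0 mY Y0 c0 H; have mL := measurable_level mY.
have E1 : (\int[P]_w (Y w)%:E = \int[P]_w (1 * (Y w)%:E))%E.
  by apply: eq_integral => w _; rewrite mul1e.
rewrite E1 !layer_cake// -ge0_integralZl//; last 2 first.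
- apply: (measurable_fun_fubini_tonelli_G (m1 := P)
    (fun z : T * MR R => 1 * level Y z.2 z.1)%E) => //.
  + by under eq_fun do rewrite mul1e.
  + by move=> z; rewrite mul1e.
- by move=> r _; apply: integral_ge0 => w _; rewrite mul1e.
apply: eq_integral => r _; have [r0|r0] := leP 0 r; last first.
  have -> : level Y r = cst 0%E.
    by apply/funext => w; rewrite /level leNgt r0.
  by rewrite !integral0_eq ?mule0// => w _; rewrite /= mule0.
have EL w : level Y r w = (\1_[set w | (r < Y w)%R] w)%:E.
  rewrite /level r0 indicE; case: (boolP (_ \in _)) => [|].
    by rewrite inE/= => ->.
  by rewrite notin_setE/= => /negP; rewrite -leNgt; case: ltP.
under eq_integral do rewrite EL; rewrite H//; congr (_ * _)%E.
have mE : measurable [set w | (r < Y w)%R].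
  rewrite -[X in measurable X]setTI.
  exact: (@measurable_fun_ltr _ _ _ setT (cst r) Y).
rewrite -[in LHS](setIT [set w | (r < Y w)%R]) -integral_indic//.
by apply: eq_integral => w _; rewrite mul1e EL.
Qed.

Lemma expectation_prod (n : nat) (Y : nat -> T -> R) :
  (forall i, measurable_fun [set: T] (Y i)) -> (forall i w, 0 <= Y i w) ->
  (forall (r : nat -> R) (s : seq nat), uniq s ->
    P (\bigcap_(i in [set` s]) [set w | (r i < Y i w)%R]) =
    \prod_(i <- s) P [set w | (r i < Y i w)%R])%E ->
  (\int[P]_w (\prod_(i < n) Y i w)%:E = \prod_(i < n) \int[P]_w (Y i w)%:E)%E.
Proof.
move=> mY Y0 indep.
have mE i r : measurable [set w | (r < Y i w)%R].
  rewrite -[X in measurable X]setTI.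
  exact: (@measurable_fun_ltr _ _ _ setT (cst r) (Y i)).
(* The factors are turned one by one from indicators of level sets into the
   variables themselves. *)
pose Z k (r : nat -> R) i w : R :=
  if (i < k)%N then Y i w else \1_[set w | (r i < Y i w)%R] w.
have mZ k r i : measurable_fun [set: T] (Z k r i).
  by rewrite /Z; case: (i < k)%N; [exact: mY|exact: measurable_indic].
have Z0 k r i w : 0 <= Z k r i w.
  by rewrite /Z; case: ifP => // _; rewrite indicE.
have key k r : (k <= n)%N ->
    (\int[P]_w (\prod_(i < n) Z k r i w)%:E = \prod_(i < n) \int[P]_w (Z k r i w)%:E)%E.
  elim: k r => [|k IH] r kn.
    pose E := \bigcap_(i in [set` iota 0 n]) [set w | (r i < Y i w)%R].
    transitivity (P E).
      have mEE : measurable E by exact: bigcap_measurableType.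
      rewrite -[in RHS](setIT E) -integral_indic//.
      apply: eq_integral => w _; congr EFin.
      rewrite indicE; case: (boolP (_ \in _)) => [|wE].
        rewrite inE => H; apply: big1 => i _; rewrite /Z/= indicE mem_set//.
        by apply: (H i); rewrite /= mem_iota/=.
      have [i ni] : exists i : 'I_n, ~ (r i < Y i w)%R.
        apply/existsNP => H; move: wE; rewrite notin_setE; apply.
        by move=> i; rewrite /= mem_iota/= => ni; exact: (H (Ordinal ni)).
      by rewrite (bigD1 i)//= /Z/= indicE memNset ?mul0r.
    rewrite indep ?iota_uniq// -[X in iota 0 X](subn0 n) big_mkord.
    apply: eq_bigr => i _.
    by rewrite -[in LHS](setIT [set w | _]) -integral_indic.
  pose k' := Ordinal kn.
  have Zk s (i : 'I_n) : i != k' ->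
      Z k.+1 r i = Z k (fun j => if j == k then s else r j) i.
    by move=> ik; rewrite /Z ltnS leq_eqVlt (negbTE (ik : i != k :> nat)).
  have Zkk s : Z k (fun j => if j == k then s else r j) k' =
      \1_[set w | (s < Y k w)%R].
    by apply/funext => w; rewrite /Z/= ltnn eqxx.
  pose W w := (\prod_(i < n | i != k') Z k.+1 r i w)%:E.
  have mW : measurable_fun [set: T] W.
    apply/measurable_EFinP.
    have -> : (fun w => \prod_(i < n | i != k') Z k.+1 r i w) =
        (fun w => \prod_(i <- [seq i <- index_enum 'I_n | i != k']) Z k.+1 r i w).
      by apply/funext => w; rewrite big_filter.
    by apply: measurable_prod => i _; exact: mZ.
  transitivity (\int[P]_w (W w * (Y k w)%:E))%E.
    apply: eq_integral => w _; rewrite (bigD1 k')//= mulrC EFinM.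
    by rewrite {2}/Z/= ltnSn.
  rewrite (bigD1 k')//= {1}/Z ltnSn muleC; apply: integral_prod_level => //.
  - by move=> w; rewrite lee_fin; apply: prodr_ge0 => i _.
  - by apply: prode_ge0 => i _; apply: integral_ge0 => w _; rewrite lee_fin.
  (* The induction hypothesis is applied with the [k]-th threshold reset to [s], so the product rule
     is available at every level of [Y k]. *)
  - move=> s s0; pose r' j := if j == k then s else r j.
    transitivity (\int[P]_w (\prod_(i < n) Z k r' i w)%:E)%E.
      apply: eq_integral => w _; rewrite (bigD1 k')//= Zkk mulrC EFinM.
      by congr (EFin _ * _)%E; apply: eq_bigr => i ik; rewrite (Zk s).
    rewrite IH ?(ltnW kn)// (bigD1 k')//= Zkk integral_indic// setIT muleC.
    by congr (_ * _)%E; apply: eq_bigr => i ik; rewrite (Zk s).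
have := key n (fun=> 0) (leqnn n).
have E i : (i < n)%N -> Z n (fun=> 0) i = Y i by move=> ni; apply/funext => w; rewrite /Z ni.
under [in X in X = _ -> _]eq_integral do under eq_bigr do rewrite E//.
by under [in X in _ = X -> _]eq_bigr do rewrite E//.
Qed.

End independence.
Section process_expectations.
Context {d : measure_display} {T : measurableType d} {R : realType}.

(** [T] is re-equipped with the sigma-algebra generated by the process; each factor is measurable
    for it, hence so is the product. *)
Lemma process_sigma_algebra_prod (X : R -> T -> R) (l : seq R) (c : R) :
  (forall r, r \in l -> 0 <= r) ->
  process_sigma_algebra X [set w | c < \prod_(r <- l) X r w].
Proof.
move=> l0.
pose G := [set E | exists t B, [/\ 0 <= t, measurable B & E = X t @^-1` B]].
have mX r : r \in l -> measurable_fun [set: g_sigma_algebraType G]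
    (X r : g_sigma_algebraType G -> R).
  move=> rl _ B mB; rewrite setTI; apply: sub_sigma_algebra.
  by exists r, B; split => //; exact: l0.
have mP : measurable_fun [set: g_sigma_algebraType G]
    (fun w : g_sigma_algebraType G => \prod_(r <- l) X r w).
  exact: measurable_prod.
have := @measurable_fun_ltr _ _ _ setT (cst c) _ (measurable_cst _) mP.
by move=> /(_ measurableT [set true]); rewrite setTI; apply.
Qed.

Lemma expectation_prod_processes (P : probability T R) (L : nat -> R -> T -> R)
    (n : nat) (l : nat -> seq R) :
  independent_processes P L ->
  (forall i r, 0 <= r -> measurable_fun [set: T] (L i r)) ->
  (forall i r w, 0 <= r -> 0 <= L i r w) ->
  (forall i r, r \in l i -> 0 <= r) ->
  (\int[P]_w (\prod_(i < n) \prod_(r <- l i) L i r w)%:E =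
   \prod_(i < n) \int[P]_w (\prod_(r <- l i) L i r w)%:E)%E.
Proof.
move=> indep mL L0 l0.
apply: (@expectation_prod _ _ _ P n (fun i w => \prod_(r <- l i) L i r w)).
- by move=> i; apply: measurable_prod => r ri; apply: mL; exact: l0 ri.
- by move=> i w; rewrite big_seq; apply: prodr_ge0 => r ri; apply: L0; exact: l0 ri.
- move=> c s us; apply: indep => // i _.
  by apply: process_sigma_algebra_prod => r; exact: l0.
Qed.

End process_expectations.

Section equal_fdd.
Context {d d' : measure_display} {T : measurableType d} {T' : measurableType d'}
  {R : realType}.
Variables (P : probability T R) (P' : probability T' R).
Variables (X : R -> T -> R) (X' : R -> T' -> R).
Hypothesis mX : forall r, 0 <= r -> measurable_fun [set: T] (X r).
Hypothesis mX' : forall r, 0 <= r -> measurable_fun [set: T'] (X' r).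
Hypothesis X0 : forall r w, 0 <= r -> 0 <= X r w.
Hypothesis X'0 : forall r w, 0 <= r -> 0 <= X' r w.

Lemma eq_fdd_expectation_prod (l : seq R) :
  eq_fdd P P' X X' -> (forall r, r \in l -> 0 <= r) ->
  (\int[P]_w (\prod_(r <- l) X r w)%:E = \int[P']_w (\prod_(r <- l) X' r w)%:E)%E.
Proof.
move=> XX' l0; set n := size l; pose t := in_tuple l.
have t0 i : 0 <= tnth t i by apply: l0; exact: mem_tnth.
(* The absolute values make [h] nonnegative on all tuples, as the change of variables requires, and
   do not alter products of nonnegative process values. *)
pose h (x : n.-tuple R) : \bar R := (\prod_(i < n) `|tnth x i|)%:E.
have mh : measurable_fun [set: n.-tuple R] h.
  apply/measurable_EFinP; apply: measurable_prod => i _.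
  by apply: measurableT_comp => //; exact: measurable_tnth.
have h0 x : (0 <= h x)%E by rewrite lee_fin; apply: prodr_ge0.
have mf : measurable_fun [set: T] (fdd X t).
  apply/measurable_fun_tnthP => i; rewrite [X in measurable_fun _ X](_ : _ = X (tnth t i)).
    exact: mX.
  by apply/funext => w; rewrite /= tnth_mktuple.
have mf' : measurable_fun [set: T'] (fdd X' t).
  apply/measurable_fun_tnthP => i; rewrite [X in measurable_fun _ X](_ : _ = X' (tnth t i)).
    exact: mX'.
  by apply/funext => w; rewrite /= tnth_mktuple.
transitivity (\int[P]_w (h \o fdd X t) w)%E.
  apply: eq_integral => w _; rewrite /h/=; congr EFin; rewrite [LHS]big_tnth.
  by apply: eq_bigr => i _; rewrite tnth_mktuple ger0_norm ?X0.
transitivity (\int[P']_w (h \o fdd X' t) w)%E; last first.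
  apply: eq_integral => w _; rewrite /h/=; congr EFin; rewrite [RHS]big_tnth.
  by apply: eq_bigr => i _; rewrite tnth_mktuple ger0_norm ?X'0.
have := ge0_integral_pushforward mf P measurableT mh (fun x _ => h0 x).
rewrite preimage_setT => <-.
have := ge0_integral_pushforward mf' P' measurableT mh (fun x _ => h0 x).
rewrite preimage_setT => <-.
apply: eq_measure_integral => B mB _; exact: XX'.
Qed.

End equal_fdd.

Section correlations.
Context {d : measure_display} {T : measurableType d} {R : realType}.
Variables (P : probability T R) (X : R -> T -> R).
Hypothesis mX : forall r, 0 <= r -> measurable_fun [set: T] (X r).
Hypothesis X0 : forall r w, 0 <= r -> 0 <= X r w.
Hypothesis sX : stationary_process P X.

(** Stationarity shifts all times by [s0 * c], which brings the first one to 0; the others are then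
    partial sums of the scaled gaps, by telescoping. *)
Lemma rho_gaps (q : nat) (c s0 : R) (l : seq R) :
  size l = q.-1 -> 0 <= c -> 0 <= s0 -> path <=%R s0 l -> (0 < q)%N ->
  (\int[P]_w (\prod_(r <- s0 :: l) X (r * c) w)%:E =
   rho P X (fun j : 'I_q.-1 => (nth 0 l j - nth 0 (s0 :: l) j) * c)%R)%E.
Proof.
move=> sl c0 s00 pl q0.
have s0l r : r \in s0 :: l -> s0 <= r.
  rewrite inE => /predU1P[->//|rl].
  by move: pl; rewrite path_sortedE; [move=> /andP[/allP/(_ _ rl)]|exact: le_trans].
pose l' := [seq (r - s0) * c | r <- s0 :: l].
have h0 : 0 <= s0 * c by rewrite mulr_ge0.
transitivity (\int[P]_w (\prod_(r <- l') X (r + s0 * c) w)%:E)%E.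
  apply: eq_integral => w _; rewrite big_map; congr EFin.
  by apply: eq_bigr => r _; rewrite mulrBl subrK.
rewrite (@eq_fdd_expectation_prod _ _ _ _ _ P P (fun r => X (r + s0 * c)) X) //.
- rewrite /rho expectation.unlock; apply: eq_integral => w _; congr EFin.
  rewrite (big_nth 0) size_map/= sl prednK// big_mkord; apply: eq_bigr => k _.
  congr (X _ w); rewrite (nth_map 0) /= ?sl ?prednK//.
  rewrite -mulr_suml; congr (_ * _).
  rewrite -(big_ord_widen _ (fun j => nth 0 l j - nth 0 (s0 :: l) j)); last first.
    by rewrite -ltnS prednK.
  rewrite -(big_mkord xpredT (fun j => nth 0 l j - nth 0 (s0 :: l) j)).
  by rewrite (telescope_sumr (fun j => nth 0 (s0 :: l) j)).
- by move=> r r0; apply: mX; rewrite addr_ge0.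
- by move=> r w r0; apply: X0; rewrite addr_ge0.
- by move=> n t B t0 mB; exact: sX.
- by move=> r /mapP[x /s0l xs ->]; rewrite mulr_ge0// subr_ge0.
Qed.

End correlations.
(** * Bounds on the correlations *)

(** y^a - 1 is the sum of y^i (y - 1) over i < a, and each term is at most y^p (y - 1) on either
    side of y = 1. *)
Lemma expr_sub1_le {R : realDomainType} (y : R) (a p : nat) : 0 <= y ->
  (a <= p)%N -> y ^+ a - 1 <= a%:R * (y ^+ p * (y - 1)).
Proof.
move=> y0; elim: a => [|a IH] ap; first by rewrite expr0 subrr mul0r.
have h : y ^+ a * (y - 1) <= y ^+ p * (y - 1).
  have [y1|/ltW y1] := leP 1 y.
    by apply: ler_wpM2r; rewrite ?subr_ge0// ler_weXn2l// ltnW.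
  by apply: ler_wnM2r; rewrite ?subr_le0// ler_wiXn2l// ltnW.
rewrite -natr1 mulrDl mul1r exprSr.
have := lerD (IH (ltnW ap)) h; apply: le_trans.
by rewrite le_eqVlt; apply/orP; left; apply/eqP; ring.
Qed.

(** Weighted AM-GM between the exponents 0 and [p], by induction on [p - a]; the increment of each
    step is [expr_sub1_le]. *)
Lemma expr_interpolation {R : realDomainType} (y : R) (a p : nat) : 0 <= y ->
  (a <= p)%N -> p%:R * y ^+ a <= (p%:R - a%:R) + a%:R * y ^+ p.
Proof.
move=> y0 /subnK <-; elim: (p - a)%N => [|k IH].
  by rewrite add0n subrr add0r.
have := expr_sub1_le y0 (leq_addl k a); move: IH.
rewrite addSn -natr1 exprSr; lra.
Qed.

Section moments.
Context {d : measure_display} {T : measurableType d} {R : realType}.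
Variables (P : probability T R) (X : R -> T -> R) (p : nat).
Hypothesis mX : forall r, 0 <= r -> measurable_fun [set: T] (X r).
Hypothesis X0 : forall r w, 0 <= r -> 0 <= X r w.
Hypothesis mean1 : ('E_P[X 0%R] = 1)%E.
Hypothesis p0 : (0 < p)%N.

Lemma moment0_ge0 k : (0 <= moment0 P X k)%E.
Proof. by apply: expectation_ge0 => w; rewrite exprn_ge0// X0. Qed.

Lemma rho_ge0 k (u : 'I_k.-1 -> R) : (forall j, 0 <= u j) -> (0 <= rho P X u)%E.
Proof.
move=> u0; apply: expectation_ge0 => w; apply: prodr_ge0 => i _.
by apply: X0; apply: sumr_ge0.
Qed.

Lemma rho0 k : rho P X (fun _ : 'I_k.-1 => 0) = moment0 P X k.
Proof.
rewrite /rho /moment0; congr expectation.body; apply/funext => w.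
by under eq_bigr do rewrite big1//; rewrite prodr_const card_ord.
Qed.

Lemma moment_root (b : R) : 1 < b -> (moment0 P X p.+1 < (b ^+ p)%:E)%E ->
  exists theta : R, [/\ 1 <= theta, theta < b &
    (moment0 P X p.+1 <= (theta ^+ p)%:E)%E].
Proof.
move=> b1; move: (moment0_ge0 p.+1).
case: (moment0 P X p.+1) => // m; rewrite lee_fin lte_fin => m0 mb.
have rm : (m `^ p%:R^-1) ^+ p = m.
  by rewrite -powR_mulrn ?powR_ge0// -powRrM mulVf ?powRr1// pnatr_eq0 -lt0n.
(* The p-th root of the moment lies strictly below [b]; the maximum with 1 keeps [theta >= 1] and,
   as [1 < b], still below [b]. *)
exists (Num.max 1 (m `^ p%:R^-1)); split; first by rewrite le_max lexx.
- rewrite gt_max b1/= ltNge; apply/negP => bm; move: mb; rewrite ltNge => /negP.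
  apply; rewrite -rm; apply: lerXn2r => //; rewrite nnegrE ?powR_ge0//.
  by rewrite ltW// (lt_trans ltr01).
- rewrite lee_fin -{1}rm; apply: lerXn2r; rewrite ?nnegrE ?powR_ge0 ?le_max ?ler01//.
  by rewrite lexx orbT.
Qed.

(* Interpolation of [X 0 ^+ k.+1] between [X 0], of mean 1, and [X 0 ^+ p.+1]. *)
Lemma moment_interpolation (theta : R) (k : nat) : 1 <= theta ->
  (moment0 P X p.+1 <= (theta ^+ p)%:E)%E -> (k <= p)%N ->
  (moment0 P X k.+1 <= (theta ^+ k)%:E)%E.
Proof.
move=> th1 mth kp; have th0 : 0 < theta by exact: lt_le_trans th1.
have mXk i : measurable_fun [set: T] (fun w => (X 0 w ^+ i)%:E).
  by apply/measurable_EFinP/measurable_funX/mX.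
have Xk0 i w : (0 <= (X 0 w ^+ i)%:E)%E by rewrite lee_fin exprn_ge0// X0.
(* The coefficients come from [expr_interpolation] at [y = x / theta], multiplied by
   [x * theta ^+ k]; they satisfy [c1 + c2 * theta ^+ p = p * theta ^+ k]. *)
pose c1 : R := (p%:R - k%:R) * theta ^+ k.
pose c2 : R := k%:R * (theta ^+ k / theta ^+ p).
have c10 : 0 <= c1 by rewrite mulr_ge0 ?exprn_ge0 ?(ltW th0)// subr_ge0 ler_nat.
have c20 : 0 <= c2 by rewrite mulr_ge0// divr_ge0// exprn_ge0// ltW.
have key : (p%:R%:E * moment0 P X k.+1 <=
    c1%:E * 'E_P[X 0%R] + c2%:E * moment0 P X p.+1)%E.
  rewrite /moment0 expectation.unlock.
  have -> : (\int[P]_w (X 0%R w)%:E = \int[P]_w (X 0%R w ^+ 1)%:E)%E by [].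
  rewrite -!ge0_integralZl// -ge0_integralD//; last 4 first.
  - by move=> w _; rewrite mule_ge0.
  - exact: measurable_funeM.
  - by move=> w _; rewrite mule_ge0.
  - exact: measurable_funeM.
  apply: ge0_le_integral => //.
  - by move=> w _; rewrite mule_ge0.
  - exact: measurable_funeM.
  - by apply: emeasurable_funD; exact: measurable_funeM.
  - move=> w _; rewrite -!EFinM -EFinD lee_fin.
    set x := X 0 w; have x0 : 0 <= x by exact: X0.
    have := expr_interpolation (divr_ge0 x0 (ltW th0)) kp.
    have tk0 : 0 <= x * theta ^+ k by rewrite mulr_ge0// exprn_ge0// ltW.
    move=> /(ler_wpM2r tk0); rewrite !expr_div_n.
    have tn0 i : theta ^+ i != 0 by rewrite expf_neq0// gt_eqF.
    have -> : p%:R * (x ^+ k / theta ^+ k) * (x * theta ^+ k) = p%:R * x ^+ k.+1.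
      by rewrite exprS; field; exact: tn0.
    move=> /le_trans; apply; rewrite le_eqVlt; apply/orP; left; apply/eqP.
    by rewrite /c1 /c2 [x ^+ p.+1]exprS expr1; field; exact: tn0.
rewrite mean1 mule1 in key.
have : (p%:R%:E * moment0 P X k.+1 <= p%:R%:E * (theta ^+ k)%:E)%E.
  apply: (le_trans key); apply: (@le_trans _ _ (c1%:E + c2%:E * (theta ^+ p)%:E)%E).
    by apply: leeD2l; apply: lee_wpmul2l.
  rewrite -!EFinM -EFinD lee_fin le_eqVlt; apply/orP; left; apply/eqP.
  by rewrite /c1 /c2; field; rewrite expf_neq0// gt_eqF.
by rewrite lee_pmul2l// lte_fin ltr0n.
Qed.

(** A run of length k contributes theta^(k-1), so the exponents add up to the total length minus the
    number of runs. The second conjunct ensures that the natural-number subtractions are not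
    truncated. *)
Lemma prod_moments_le (theta : R) (x : nat) (s : seq nat) : 1 <= theta ->
  (moment0 P X p.+1 <= (theta ^+ p)%:E)%E ->
  path ltn x s -> (last x s <= p.+1)%N ->
  (\prod_(k <- pairmap (fun i j => (j - i)%N) x s) moment0 P X k <=
   (theta ^+ (last x s - x - size s))%:E)%E /\ (x + size s <= last x s)%N.
Proof.
move=> th1 mth; elim: s x => [|y s IH] x /=.
  by move=> _ _; rewrite big_nil subnn expr0 addn0.
move=> /andP[xy ys] lq; have [IH1 IH2] := IH y ys lq; split; last first.
  by rewrite addnS -addSn; apply: leq_trans IH2; rewrite leq_add2r.
have xy0 : (0 < y - x)%N by rewrite subn_gt0.
rewrite big_cons.
have -> : (last y s - x - (size s).+1 = (y - x).-1 + (last y s - y - size s))%N.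
  move: IH2 xy => /=; clear; move: (last y s) (size s) => l n.
  by move=> h1 h2; rewrite /= in h2; lia.
rewrite exprD EFinM; apply: lee_pmul => //.
- exact: moment0_ge0.
- by apply: prode_ge0 => i _; exact: moment0_ge0.
- rewrite -{1}(prednK xy0); apply: moment_interpolation => //.
  have : (y <= last y s)%N by apply: leq_trans IH2; rewrite leq_addr.
  by move=> h; rewrite -ltnS prednK//; apply: leq_trans (leq_subr _ _) (leq_trans h lq).
Qed.

End moments.

(** * Geometric growth and summable excesses *)

Lemma geometric_eventually_ge {R : realType} (b A : R) : 1 < b ->
  exists2 a : nat, (0 < a)%N & A <= b ^+ a.
Proof.
move=> b1; have b0 : 0 < b - 1 by rewrite subr_gt0.
(* This [n] satisfies [A <= n * (b - 1)], and Bernoulli's inequality bounds [b ^+ n] below by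
   [1 + n * (b - 1)]. *)
exists (Num.truncn (A / (b - 1))).+1 => //.
set n := (Num.truncn _).+1.
have An : A <= n%:R * (b - 1).
  rewrite -ler_pdivrMr//; have [A0|A0] := leP 0 (A / (b - 1)).
    by apply/ltW; rewrite /n truncnS_gt.
  by apply: le_trans (ltW A0) _.
apply: (le_trans An).
have : 1 + n%:R * (b - 1) <= b ^+ n.
  elim: n {An} => [|n IH]; first by rewrite mul0r addr0 expr0.
  rewrite exprS -natr1.
  have := ler_wpM2l (ltW (lt_trans ltr01 b1)) IH.
  have : 0 <= n%:R * (b - 1) * (b - 1) by rewrite !mulr_ge0// ltW.
  nra.
lra.
Qed.

(** Each factor is at most the exponential of [Num.max 0 (x k)], by 1 + x <= exp x. *)
Lemma prod_max1_bounded {R : realType} (x : nat -> R) (S : R) :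
  (forall n, \sum_(k < n) Num.max 0 (x k) <= S) ->
  forall n, \prod_(k < n) Num.max 1 (1 + x k) <= expR S.
Proof.
move=> xS n; apply: (@le_trans _ _ (expR (\sum_(k < n) Num.max 0 (x k)))); last first.
  by rewrite ler_expR.
elim: n => [|n IH]; first by rewrite !big_ord0 expR0.
rewrite !big_ord_recr/= expRD; apply: ler_pM => //.
- by apply: prodr_ge0 => i _; rewrite le_max ler01.
- by rewrite le_max ler01.
- rewrite ge_max; apply/andP; split.
    by rewrite -expR0 ler_expR le_max lexx.
  apply: le_trans (expR_ge1Dx _); rewrite lerD2l le_max lexx orbT//.
Qed.

(* For a nonincreasing sequence, a series bounded above has a summable positive
   part: the terms are either all nonnegative or eventually negative. *)
Lemma nonincreasing_positive_part {R : realType} (x : nat -> R) :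
  (forall n m, (n <= m)%N -> x m <= x n) ->
  (\sum_(1 <= n <oo) (x n)%:E < +oo)%E ->
  exists S, forall a n, (0 < a)%N -> \sum_(k < n) Num.max 0 (x (a + k)%N) <= S.
Proof.
move=> xnon xfin; pose y k := Num.max 0 (x k).
have y0 k : 0 <= y k by rewrite le_max lexx.
suff [S HS] : exists S, forall n, \sum_(1 <= k < n) y k <= S.
  exists S => a n a0; apply: le_trans (HS (a + n)%N).
  rewrite (big_cat_nat a0 (leq_addr n a))/=.
  rewrite -[X in index_iota X (a + n)](add0n a) big_addn addKn big_mkord.
  rewrite ler_wpDl//; first exact: sumr_ge0.
  by rewrite le_eqVlt; apply/orP; left; apply/eqP; apply: eq_bigr => i _; rewrite addnC.
have [allpos|] := pselect (forall k, (1 <= k)%N -> 0 <= x k).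
  exists (fine (\sum_(1 <= n <oo) (x n)%:E)%E) => n.
  have le_n : (\sum_(1 <= k < n) (x k)%:E <= \sum_(1 <= k <oo) (x k)%:E)%E.
    apply: nneseries_lim_ge => k k1 _; by rewrite lee_fin allpos.
  rewrite -lee_fin fineK; last first.
    rewrite ge0_fin_numE//; apply: nneseries_ge0 => k k1 _; by rewrite lee_fin allpos.
  apply: le_trans le_n; rewrite -sumEFin le_eqVlt; apply/orP; left; apply/eqP.
  rewrite big_nat [RHS]big_nat; apply: eq_bigr => k /andP[k1 _].
  by rewrite /y (max_idPr (allpos _ k1)).
move=> /existsNP[k0 /not_implyP[k01 /negP]]; rewrite -ltNge => xk0.
exists (\sum_(1 <= k < k0) y k) => n.
have [nk|kn] := leqP n k0.
  have [n1|n1] := leqP n 1; first by rewrite big_geq ?sumr_ge0.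
  by rewrite (big_cat_nat _ nk)/= ?(ltnW n1)// lerDl sumr_ge0.
rewrite (big_cat_nat k01 (ltnW kn))/= -[leRHS]addr0 lerD2l.
rewrite big_nat big1// => k /andP[kk _]; rewrite /y; apply/max_idPl/ltW.
exact: le_lt_trans (xnon _ _ kk) xk0.
Qed.

(** * The product of the correlations over the levels *)

Section rho_bound.
Context {d : measure_display} {T : measurableType d} {R : realType}.
Variables (P : probability T R) (X : R -> T -> R) (p : nat) (b : R).
Hypothesis mX : forall r, 0 <= r -> measurable_fun [set: T] (X r).
Hypothesis X0 : forall r w, 0 <= r -> 0 <= X r w.
Hypothesis mean1 : ('E_P[X 0%R] = 1)%E.
Hypothesis p0 : (0 < p)%N.
Hypothesis b1 : 1 < b.
Hypothesis decr : rho_decreasing P X p.+1.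
Hypothesis momentb : (moment0 P X p.+1 < (b ^+ p)%:E)%E.
Hypothesis sum_fin : (\sum_(1 <= n <oo)
  (rho P X (fun _ : 'I_p.+1.-1 => (b ^+ n)%R) - 1) < +oo)%E.
Hypothesis mix : mixing P X p.+1.

Local Notation rhoX u := (@rho _ _ _ P X p.+1 u%R).

Let b_gt0 : 0 < b. Proof. exact: lt_trans b1. Qed.

Lemma rho_le_moment (u : 'I_p -> R) : (forall j, 0 <= u j) ->
  (rhoX u <= moment0 P X p.+1)%E.
Proof. by move=> u0; rewrite -(rho0 P X p.+1); apply: decr. Qed.

Lemma rho_fin_num (u : 'I_p -> R) : (forall j, 0 <= u j) ->
  rhoX u \is a fin_num.
Proof.
move=> u0; rewrite ge0_fin_numE; last exact: rho_ge0.
exact: le_lt_trans (rho_le_moment u0) (lt_trans momentb (ltry _)).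
Qed.

(** Raising the factors below 1 to 1 leaves only the positive part of [rho - 1], whose partial sums
    are bounded by [nonincreasing_positive_part]. The offset satisfies [0 < a] because the series
    starts at 1. *)
Lemma prod_rho_diag_bounded : exists2 K : R, 0 <= K & forall a n, (0 < a)%N ->
  \prod_(k < n)
    Num.max 1 (fine (rhoX (fun=> b ^+ (a + k)))) <= K.
Proof.
have bn0 n : 0 <= b ^+ n by rewrite exprn_ge0// ltW.
pose x n := fine (rhoX (fun=> b ^+ n)) - 1.
have xE n : (x n)%:E = (rhoX (fun=> b ^+ n) - 1)%E.
  by rewrite /x EFinB fineK// rho_fin_num.
have xnon n m : (n <= m)%N -> x m <= x n.
  move=> nm; rewrite lerD2r fine_le ?rho_fin_num//.
  by apply: decr => // j; rewrite ler_weXn2l// ltW.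
have xfin : (\sum_(1 <= n <oo) (x n)%:E < +oo)%E.
  by under eq_eseriesr do rewrite xE.
have [S HS] := nonincreasing_positive_part xnon xfin.
exists (expR S); first exact: expR_ge0.
move=> a n a0.
have := prod_max1_bounded (x := fun k => x (a + k)%N) (fun n => HS a n a0) n.
apply: le_trans; rewrite le_eqVlt; apply/orP; left; apply/eqP.
by apply: eq_bigr => k _; rewrite /x [1 + _]addrC subrK.
Qed.

(* Splitting a run of [p + 1] times at [#|S|] large gaps leaves [p - #|S|] small
   gaps, and the limiting correlation is at most [theta] for each of them. *)
Lemma rho_pattern_bound : exists theta : R, exists a : nat,
  [/\ 1 <= theta, theta < b, (0 < a)%N,
      (moment0 P X p.+1 <= (theta ^+ p)%:E)%E &
      forall S : {set 'I_p}, (0 < #|S| < p)%N ->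
        (rhoX (fun j => if j \in S then b ^+ a else 0)
          <= (theta ^+ (p - #|S|))%:E)%E].
Proof.
have [th0 [th01 th0b mth0]] := moment_root X0 p0 b1 momentb.
(* The room between [th0] and [th] turns a bound on the limit as the gaps grow into a bound at a
   finite gap. *)
pose th := (th0 + b) / 2.
have th0th : th0 < th by rewrite /th midf_lt.
have thb : th < b by rewrite /th midf_lt.
have near_pattern : \forall A \near +oo, forall S : {set 'I_p}, (0 < #|S| < p)%N ->
    (rhoX (fun j => if j \in S then A else 0)
      < (th ^+ (p - #|S|))%:E)%E.
  (* There are finitely many sets [S], so one threshold serves them all. *)
  apply: filter_forall => S.
  have [/andP[S0 Sp]|SN] := boolP (0 < #|S| < p)%N; last exact: nearW.
  (* The mixing condition numbers the gaps from 1, whereas ordinals start at 0. *)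
  pose C := map (fun j : 'I_p => j.+1) (enum S).
  have sizeC : size C = #|S| by rewrite size_map -cardE.
  have memC (j : 'I_p) : (j.+1 \in C) = (j \in S).
    by rewrite (mem_map (f := fun j : 'I_p => (j : nat).+1)) ?mem_enum// => i i' [] /val_inj.
  have Cb : all (fun i => (1 <= i <= p.+1.-1)%N) C.
    by apply/allP => _ /mapP[j _ ->]; rewrite /= ltn_ord.
  have sC : sorted ltn C.
    rewrite /C (map_comp succn) sorted_map.
    have : subseq (map val (enum S)) (iota 0 p).
      rewrite -val_enum_ord; apply: map_subseq.
      by rewrite {1}/enum_mem -enumT; exact: filter_subseq.
    by move=> /(subseq_sorted ltn_trans); apply; exact: iota_ltn_sorted.
  have pC : path ltn 0%N (rcons C p.+1).
    rewrite rcons_path path_sortedE; last exact: ltn_trans.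
    rewrite sC andbT; apply/andP; split.
      by apply/allP => i /(allP Cb) /andP[].
    have := mem_last 0%N C; rewrite inE => /predU1P[->//|].
    by move=> /(allP Cb) /andP[_]; rewrite /= -ltnS.
  have [prodle _] := prod_moments_le mX X0 mean1 p0 th01 mth0 pC
    (eq_leq (last_rcons _ _ _)).
  have lim := mix sC Cb; rewrite sizeC in lim; have {}lim := lim S0 Sp.
  have lt_lim : (\prod_(k <- pairmap (fun i j => (j - i)%N) 0%N (rcons C p.+1)) moment0 P X k
      < (th ^+ (p - #|S|))%:E)%E.
    apply: (le_lt_trans prodle); rewrite last_rcons size_rcons sizeC subn0 subSS.
    rewrite lte_fin ltr_pXn2r ?subn_gt0// nnegrE.
      by rewrite (le_trans ler01).
    by rewrite (le_trans ler01)// (le_trans th01)// ltW.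
  apply: filterS (cvge_lt lim lt_lim) => A H _.
  by under eq_fun do rewrite -memC.
have [M [_ HM]] := near_pattern.
(* The threshold property holds strictly above [M], hence the target [M + 1]. *)
have [a a0 Ma] := geometric_eventually_ge (M + 1) b1.
exists th, a; split => //.
- by rewrite (le_trans th01)// ltW.
- by apply: (le_trans mth0); rewrite lee_fin lerXn2r ?nnegrE ?(le_trans ler01)//
    ?(le_trans th01)// ltW.
- by move=> S Sp; apply/ltW/HM => //; apply: lt_le_trans Ma; rewrite ltrDl.
Qed.

(** Since [b > 1], once all gaps are large they stay large, so the levels with a small gap form an
    initial segment. There the mixing patterns give the powers of [theta]; afterwards the diagonal
    correlations give the constant [K]. *)
Lemma prod_rho_bound : exists theta B K : R,
  [/\ 1 <= theta, theta < b, 0 < B, 0 <= K &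
    forall (u : 'I_p -> R) (N : nat), (forall j, 0 <= u j) ->
    (\prod_(i < N) rhoX (fun j => u j * b ^+ i) <=
     (K * \prod_(j < p) \prod_(i < N) (if (u j * b ^+ i < B)%R then theta else 1))%:E)%E].
Proof.
have [th [a [th1 thb a0 mth pattern]]] := rho_pattern_bound.
have [K K0 HK] := prod_rho_diag_bounded.
have th_ge0 : 0 <= th by exact: le_trans th1.
pose B := b ^+ a; have B0 : 0 < B by rewrite exprn_gt0.
exists th, B, K; split => // u N u0.
pose v i (j : 'I_p) := u j * b ^+ i.
have v0 i j : 0 <= v i j by rewrite mulr_ge0// exprn_ge0// ltW.
pose F i : R := \prod_(j < p) (if v i j < B then th else 1).
have F0 i : 0 <= F i by apply: prodr_ge0 => j _; case: ifP.
pose D k : R := Num.max 1 (fine (rhoX (fun=> b ^+ (a + k)))).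
have D0 k : 0 <= D k by rewrite le_max ler01.
have FE i : F i = th ^+ (p - #|[set j | B <= v i j]%SET|).
  rewrite /F -big_mkcond prodr_const; congr (_ ^+ _).
  have := cardsC [set j | B <= v i j]%SET; rewrite card_ord => pE.
  rewrite -[X in (X - _)%N]pE addKn.
  by apply: eq_card => j; rewrite !inE -ltNge.
(* By monotonicity the large gaps may be lowered to [B] and the small ones to 0, which is the
   pattern of [S]; if [S] is empty, the full moment is the bound. *)
have small i : (exists j, v i j < B) -> (rhoX (v i) <= (F i)%:E)%E.
  move=> [j0 vj0]; set S := [set j | B <= v i j]%SET in FE *.
  have Sp : (#|S| < p)%N.
    rewrite -[X in (_ < X)%N](card_ord p) -cardsT; apply: proper_card.
    by rewrite properT; apply/eqP => /setP /(_ j0); rewrite !inE leNgt vj0.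
  rewrite FE; have [S0|S0] := posnP #|[set j | B <= v i j]%SET|.
    by rewrite S0 subn0; apply: le_trans mth; exact: rho_le_moment.
  apply: (le_trans _ (pattern S _)); last by rewrite Sp andbT.
  apply: decr => j; first by case: ifP => // _; exact: ltW.
  by rewrite inE; case: ifP.
(* [c] counts the levels at which all gaps are large; at the next such level every
   gap is at least [b ^+ (a + c)]. *)
suff [c [Hc _]] : exists c : nat,
    (\prod_(i < N) rhoX (v i) <= (\prod_(k < c) D k * \prod_(i < N) F i)%:E)%E /\
    (c = 0%N \/ forall j, b ^+ (a + c) <= v N j).
  apply: (le_trans Hc); rewrite lee_fin exchange_big/=.
  apply: ler_wpM2r; last exact: HK.
  by apply: prodr_ge0 => j _; apply: prodr_ge0 => i _; case: ifP.
elim: N => [|N [c [IH Hc]]].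
  by exists 0%N; rewrite !big_ord0 mul1r; split => //; left.
have prod0 : (0 <= \prod_(i < N) rhoX (v i))%E.
  by apply: prode_ge0 => i _; exact: rho_ge0.
have [sm|lg] := pselect (exists j, v N j < B).
  (* A positive [c] would put every gap at or above [b ^+ (a + c) >= B], against the presence of a
     small gap. *)
  have c0 : c = 0%N.
    case: Hc => // Hc; have [j vj] := sm; have := Hc j.
    rewrite leNgt; move/negP; case; apply: (lt_le_trans vj).
    by rewrite /B ler_weXn2l ?leq_addr// ltW.
  exists 0%N; split; last by left.
  rewrite c0 big_ord0 mul1r in IH.
  rewrite !big_ord_recr/= big_ord0 mul1r EFinM; apply: lee_pmul => //.
    exact: rho_ge0.
  exact: small.
have vB j : B <= v N j by rewrite leNgt; apply/negP => h; apply: lg; exists j.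
have vN j : b ^+ (a + c) <= v N j.
  by case: Hc => [->|//]; rewrite addn0.
exists c.+1; split.
  have F1 : F N = 1 by apply: big1 => j _; rewrite ltNge vB.
  rewrite big_ord_recr/= [\prod_(k < c.+1) _]big_ord_recr/= [\prod_(i < N.+1) F i]big_ord_recr/=.
  rewrite F1 mulr1 mulrAC EFinM; apply: lee_pmul => //; first exact: rho_ge0.
  apply: (@le_trans _ _ (rhoX (fun=> b ^+ (a + c)))).
    by apply: decr => // j; rewrite exprn_ge0// ltW.
  rewrite -[leLHS]fineK ?lee_fin ?le_max ?lexx ?orbT//.
  by apply: rho_fin_num => j; rewrite exprn_ge0// ltW.
right => j; rewrite /v addnS !exprSr mulrA.
by apply: ler_wpM2r; [exact: ltW|exact: vN].
Qed.

End rho_bound.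

(** * The kernel of a single gap *)

Section gap_kernel.
Context {R : realType}.
Variables (theta b B : R).
Hypothesis th1 : 1 <= theta.
Hypothesis thb : theta < b.
Hypothesis B0 : 0 < B.

Definition gap_kernel (N : nat) (u : R) : R :=
  \prod_(i < N) (if u * b ^+ i < B then theta else 1).

Let th0 : 0 < theta. Proof. exact: lt_le_trans th1. Qed.
Let b0 : 0 < b. Proof. exact: lt_trans thb. Qed.

Lemma gap_kernel_ge0 N u : 0 <= gap_kernel N u.
Proof. by apply: prodr_ge0 => i _; case: ifP => // _; exact: ltW. Qed.

Lemma measurable_gap_kernel N : measurable_fun [set: MR R] (gap_kernel N).
Proof.
apply: measurable_prod => i _; apply: measurable_fun_ifT => //.
apply: measurable_fun_ltr => //.
exact: (measurable_funM (@measurable_id _ (MR R) setT) (measurable_cst _)).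
Qed.

(** If [i] is the last level with [u * b ^+ i < B], the kernel is at most [theta ^+ i.+1], which is
    one of the terms; if there is none, it is 1. *)
Lemma gap_kernel_le N u :
  gap_kernel N u <= 1 + \sum_(i < N) theta ^+ i.+1 * (u * b ^+ i < B)%R%:R.
Proof.
elim: N => [|N IH]; first by rewrite /gap_kernel !big_ord0 addr0.
rewrite big_ord_recr/= addrA /gap_kernel big_ord_recr/=.
case: ifP => _; last by rewrite mulr1 mulr0 addr0.
rewrite mulr1; apply: (@le_trans _ _ (theta ^+ N.+1)).
  rewrite exprSr; apply: ler_wpM2r; first exact: ltW.
  rewrite -[X in theta ^+ X](card_ord N) -prodr_const.
  by apply: ler_prod => i _; case: ifP => _; rewrite ?ler01 ?lexx ?th1 ?(ltW th0).
by rewrite lerDr addr_ge0// sumr_ge0// => i _; rewrite mulr_ge0// exprn_ge0// ltW.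
Qed.

(** Level [i] is small only for [v] in an interval of length [B / b ^+ i]. Weighted by
    [theta ^+ i.+1], these lengths form a geometric series of ratio [theta / b < 1]; the constant
    term 1 contributes at most the length of [s, t]. *)
Lemma integral_gap_kernel_bounded : exists2 C : R, 0 <= C &
  forall N (s t : R), 0 <= s -> s <= t -> t <= 1 ->
  (\int[lebesgue_measure]_(v in `[s, t]) (gap_kernel N (v - s))%:E <= C%:E)%E.
Proof.
pose x := theta / b; have x0 : 0 <= x by rewrite divr_ge0// ltW.
have x1 : x < 1 by rewrite ltr_pdivrMr// mul1r.
have x1' : 0 < 1 - x by rewrite subr_gt0.
have geo N : \sum_(i < N) x ^+ i <= (1 - x)^-1.
  rewrite -[leRHS]mul1r ler_pdivlMr// mulrC -opprB mulNr -subrX1 opprB.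
  by rewrite lerBlDr lerDl exprn_ge0.
exists (1 + theta * B * (1 - x)^-1).
  by rewrite addr_ge0// !mulr_ge0 ?invr_ge0 ?ltW.
move=> N s t s0 st t1.
pose J (i : nat) : set (MR R) := `[s, s + B / b ^+ i]%classic.
have mJ i : measurable (J i) by exact: measurable_itv.
pose h (i : nat) (v : MR R) : \bar R := ((theta ^+ i.+1)%:E * (\1_(J i) v)%:E)%E.
have h0 i v : (0 <= h i v)%E.
  by rewrite mule_ge0// lee_fin ?exprn_ge0 ?(ltW th0)// indicE.
have mh i : measurable_fun [set: MR R] (h i).
  by apply: measurable_funeM; apply/measurable_EFinP; exact: measurable_indic.
have mker : measurable_fun [set: MR R] (fun v => (gap_kernel N (v - s))%:E).
  apply/measurable_EFinP; apply: (measurableT_comp (measurable_gap_kernel N)).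
  exact: (measurable_funB (@measurable_id _ (MR R) setT) (measurable_cst _)).
have msum : measurable_fun [set: MR R] (fun v => \sum_(i < N) h i v)%E.
  by apply: emeasurable_sum => i; exact: mh.
apply: (@le_trans _ _ (\int[lebesgue_measure]_(v in `[s, t]) (1 + \sum_(i < N) h i v))%E).
  apply: ge0_le_integral => //.
  - by move=> v _; rewrite lee_fin gap_kernel_ge0.
  - exact: measurable_funTS.
  - by apply: measurable_funTS; apply: emeasurable_funD.
  - move=> v; rewrite /= in_itv/= => /andP[sv vt].
    apply: (@le_trans _ _ (1 + \sum_(i < N) theta ^+ i.+1 * ((v - s) * b ^+ i < B)%R%:R)%:E).
      by rewrite lee_fin gap_kernel_le.
    rewrite EFinD -sumEFin; apply: leeD2l; apply: lee_sum => i _.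
    rewrite /h -EFinM lee_fin; apply: ler_wpM2l; first by rewrite exprn_ge0// ltW.
    rewrite indicE; case: (boolP (_ < _)) => // vB.
    rewrite mem_set// /J/= in_itv/= sv/= -lerBlDl ler_pdivlMr ?exprn_gt0//.
    exact: ltW.
rewrite ge0_integralD//; last 2 first.
- by move=> v _; exact: sume_ge0.
- exact: measurable_funTS.
rewrite EFinD; apply: leeD.
  rewrite integral_cst//= mul1e.
  have := lebesgue_measure_itv `[s, t]; rewrite /= => ->; rewrite lte_fin.
  case: ifP => _; last by rewrite lee_fin.
  by rewrite -EFinB lee_fin; lra.
rewrite ge0_integral_sum//; last first.
  by move=> i; exact: measurable_funTS.
apply: (@le_trans _ _ (\sum_(i < N) (theta ^+ i.+1 * (B / b ^+ i))%:E)%E).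
  apply: lee_sum => i _; rewrite ge0_integralZl//; last 2 first.
  - by apply: measurable_funTS; apply/measurable_EFinP; exact: measurable_indic.
  - by rewrite lee_fin exprn_ge0// ltW.
  rewrite EFinM; apply: lee_wpmul2l; first by rewrite lee_fin exprn_ge0// ltW.
  rewrite integral_indic//.
  apply: (@le_trans _ _ (lebesgue_measure (J i))).
    by apply: le_measure; rewrite ?inE//; exact: measurableI.
  have := lebesgue_measure_itv `[s, s + B / b ^+ i]; rewrite /J/= => ->.
  rewrite lte_fin ltrDl divr_gt0 ?exprn_gt0//.
  by rewrite -EFinB lee_fin addrAC subrr add0r.
rewrite sumEFin lee_fin.
have -> : \sum_(i < N) theta ^+ i.+1 * (B / b ^+ i) = theta * B * \sum_(i < N) x ^+ i.
  rewrite mulr_sumr; apply: eq_bigr => i _; rewrite /x expr_div_n exprS.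
  by field; rewrite expf_neq0// gt_eqF.
by apply: ler_wpM2l; rewrite ?geo// mulr_ge0// ltW.
Qed.

End gap_kernel.
(** * The cumulative process *)

Section lacunary_products.
Context {d0 : measure_display} {T0 : measurableType d0} {R : realType}.
Context {d : measure_display} {T : measurableType d}.
Variables (P0 : probability T0 R) (P : probability T R).
Variables (Lambda : R -> T0 -> R) (b : R) (L : nat -> R -> T -> R).
Hypothesis hLambda : mother_process P0 Lambda.
Hypothesis hb : 1 < b.
Hypothesis hL : rescaled_copies P0 P Lambda b L.

Let b0 : 0 < b. Proof. exact: lt_trans hb. Qed.

Let mD : measurable ([set t : R | 0 <= t] : set R).
Proof. by rewrite -set_itvcy; exact: measurable_itv. Qed.

Let measurable_section d' (T' : measurableType d') (X : R -> T' -> R) r :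
  measurable_process X -> 0 <= r -> measurable_fun [set: T'] (X r).
Proof.
move=> mX r0; apply: (measurable_comp (F := [set t : R | 0 <= t] `*` [set: T'])
  (f := fun p : R * T' => X p.1 p.2) (g := fun w => (r, w))) => //.
- exact: measurableX.
- by move=> _ [w _ <-].
- exact: pair1_measurable.
Qed.

Let mLambda r : 0 <= r -> measurable_fun [set: T0] (Lambda r).
Proof. by have [mX _ _ _ _] := hLambda; exact: measurable_section. Qed.

Let Lambda0 r w : 0 <= r -> 0 <= Lambda r w.
Proof. by have [_ _ _ pX _] := hLambda; move=> r0; apply/ltW/pX. Qed.

Let mL i r : 0 <= r -> measurable_fun [set: T] (L i r).
Proof. by have [/(_ i)[mX _ _ _] _] := hL; exact: measurable_section. Qed.

Let L0 i r w : 0 <= r -> 0 <= L i r w.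
Proof. by have [/(_ i)[_ _ pX _] _] := hL; move=> r0; apply/ltW/pX. Qed.

(* [Lambda_prod] extended to negative times, so as to be measurable and
   nonnegative on the whole of [R * T]. *)
Definition extended_prod (n : nat) (s : R) (w : T) : R :=
  Lambda_prod L n (Num.max 0 s) w.

Lemma extended_prod_ge0 n s w : 0 <= extended_prod n s w.
Proof. by apply: prodr_ge0 => i _; apply: L0; rewrite le_max lexx. Qed.

Lemma measurable_extended_prod n :
  measurable_fun [set: MR R * T] (fun z => extended_prod n z.1 z.2).
Proof.
apply: (@measurable_prod _ _ _ setT _ (index_enum 'I_n.+1)
  (fun i (z : MR R * T) => L i (Num.max 0 z.1) z.2)) => i _.
have [/(_ i)[mX _ _ _] _] := hL.
have mm : measurable_fun [set: MR R * T]
    (fun z => (Num.max 0 z.1 : R, z.2) : R * T).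
  apply: measurable_fun_pair => //.
  apply: measurable_maxr; first exact: measurable_cst.
  exact: (@measurable_fst _ _ (MR R) T).
apply: (measurable_comp (F := [set t : R | 0 <= t] `*` [set: T])
  (f := fun p : R * T => L i p.1 p.2)
  (g := fun z : MR R * T => (Num.max 0 z.1 : R, z.2) : R * T)) => //.
- exact: measurableX.
- by move=> _ [z _ <-]; split => //=; rewrite le_max lexx.
Qed.

Lemma copy_expectation (i : nat) (l : seq R) : (forall r, r \in l -> 0 <= r) ->
  (\int[P]_w (\prod_(r <- l) L i r w)%:E =
   \int[P0]_w (\prod_(r <- l) Lambda (r * b ^+ i) w)%:E)%E.
Proof.
move=> l0; have bi0 : 0 <= b ^+ i by rewrite exprn_ge0// ltW.
apply: (eq_fdd_expectation_prod (X' := fun r => Lambda (r * b ^+ i))) => //.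
- exact: mL.
- by move=> r r0; apply: mLambda; exact: mulr_ge0.
- exact: L0.
- by move=> r w r0; apply: Lambda0; exact: mulr_ge0.
- by have [/(_ i)[]] := hL.
Qed.

Lemma copy_mean (i : nat) (s : R) : 0 <= s -> (\int[P]_w (L i s w)%:E = 1)%E.
Proof.
move=> s0; have [_ _ _ _ mean] := hLambda.
have sb0 : 0 <= s * b ^+ i by rewrite mulr_ge0// exprn_ge0// ltW.
rewrite -(mean _ sb0) expectation.unlock.
transitivity (\int[P]_w (\prod_(r <- [:: s]) L i r w)%:E)%E.
  by apply: eq_integral => w _; rewrite big_seq1.
rewrite copy_expectation; last by move=> r; rewrite inE => /eqP ->.
by apply: eq_integral => w _; rewrite big_seq1.
Qed.

(** By independence both sides factor over the levels. Levels up to [n] agree, and each later one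
    contributes the mean 1 of a single copy at time [s]. *)
Lemma extended_prod_mart (n m : nat) (l : seq R) (s : R) : (n <= m)%N ->
  (\int[P]_w (\prod_(r <- l) extended_prod n r w * extended_prod m s w)%:E =
   \int[P]_w (\prod_(r <- l) extended_prod n r w * extended_prod n s w)%:E)%E.
Proof.
move=> nm; set s' := Num.max 0 s; pose l' := [seq Num.max 0 r | r <- l].
have s'0 : 0 <= s' by rewrite le_max lexx.
(* The times at which copy [i] is evaluated, clipped at 0: all of them up to level [n], only [s']
   beyond. *)
pose li i := if (i < n.+1)%N then rcons l' s' else [:: s'].
have li0 i r : r \in li i -> 0 <= r.
  rewrite /li; case: ifP => _; rewrite ?mem_rcons !inE; last by move=> /eqP ->.
  by move=> /predU1P[->//|/mapP[x _ ->]]; rewrite le_max lexx.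
have [_ indep] := hL.
have E k : (n <= k)%N ->
    (\int[P]_w (\prod_(r <- l) extended_prod n r w * extended_prod k s w)%:E =
     \prod_(i < k.+1) \int[P]_w (\prod_(r <- li i) L i r w)%:E)%E.
  move=> nk; rewrite -(expectation_prod_processes _ indep mL L0 li0).
  apply: eq_integral => w _; congr EFin; rewrite exchange_big/=.
  rewrite (big_ord_widen k.+1 (fun i => \prod_(r <- l) L i (Num.max 0 r) w)) ?ltnS//.
  rewrite big_mkcond -big_split/=; apply: eq_bigr => i _; rewrite /li.
  case: ifP => _; last by rewrite mul1r big_seq1.
  by rewrite big_rcons/= big_map.
rewrite !E//.
rewrite -(big_mkord xpredT (fun i => \int[P]_w (\prod_(r <- li i) L i r w)%:E)%E).
rewrite (@big_cat_nat _ _ _ n.+1)//= big_mkord.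
rewrite [X in (_ * X)%E]big_nat [X in (_ * X)%E]big1 ?mule1// => i /andP[ni _].
rewrite /li ltnNge ni/=; under eq_integral do rewrite big_seq1.
exact: copy_mean.
Qed.

Lemma extended_prod_rho (n p : nat) (s0 : R) (l : seq R) : size l = p ->
  0 <= s0 -> path <=%R s0 l ->
  (\int[P]_w (\prod_(r <- s0 :: l) extended_prod n r w)%:E =
   \prod_(i < n.+1) @rho _ _ _ P0 Lambda p.+1
     (fun j : 'I_p => (nth 0 l j - nth 0 (s0 :: l) j) * b ^+ i)%R)%E.
Proof.
move=> sl s00 pl; have [_ indep] := hL; have [_ _ sX _ _] := hLambda.
have l0 r : r \in s0 :: l -> 0 <= r.
  rewrite inE => /predU1P[->//|rl]; apply: (le_trans s00).
  by move: pl; rewrite path_sortedE; [move=> /andP[/allP/(_ _ rl)]|exact: le_trans].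
transitivity (\int[P]_w (\prod_(i < n.+1) \prod_(r <- s0 :: l) L i r w)%:E)%E.
  apply: eq_integral => w _; rewrite exchange_big/=; congr EFin.
  apply: eq_bigr => i _; rewrite big_seq [RHS]big_seq; apply: eq_bigr => r rl.
  by rewrite (max_idPr (l0 _ rl)).
rewrite (expectation_prod_processes (l := fun=> s0 :: l) _ indep mL L0 (fun=> l0)).
apply: eq_bigr => i _; rewrite copy_expectation//.
by rewrite (rho_gaps mLambda Lambda0 sX (q := p.+1))// exprn_ge0// ltW.
Qed.

Variable p : nat.
Hypothesis p0 : (0 < p)%N.
Hypothesis hdecr : rho_decreasing P0 Lambda p.+1.
Hypothesis hmoment : (moment0 P0 Lambda p.+1 < (b ^+ p)%:E)%E.
Hypothesis hsum : (\sum_(1 <= n <oo)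
  (rho P0 Lambda (fun _ : 'I_p.+1.-1 => (b ^+ n)%R) - 1) < +oo)%E.
Hypothesis hmix : mixing P0 Lambda p.+1.
Variable t : R.
Hypothesis t0 : 0 <= t.
Hypothesis t1 : t <= 1.

(** The bound on the correlations factors into one [gap_kernel] per gap, whose integral is at most
    [C] uniformly in [n]. The kernel has [n.+1] levels because they are numbered from 0 to [n]. *)
Lemma cumul_moments_bounded : exists S : R, forall n,
  (\int[P]_w (cumul t (extended_prod n) 0 w ^+ p.+1) <= S%:E)%E.
Proof.
have [_ _ _ _ mean] := hLambda.
have [th [B [K [th1 thb B0 K0 HK]]]] :=
  prod_rho_bound mLambda Lambda0 (mean 0 (lexx 0)) p0 hb hdecr hmoment hsum hmix.
have [C C0 HC] := integral_gap_kernel_bounded th1 thb B0.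
exists (p.+1`!%:R * (K * C ^+ p) * t) => n.
apply: (iterated_moment_bound (g := gap_kernel th b B n.+1)) => //.
- exact: measurable_extended_prod.
- exact: extended_prod_ge0.
- exact: measurable_gap_kernel.
- exact: gap_kernel_ge0.
- by move=> s s0 st; exact: HC.
- move=> s0 l sl /and3P[s00 pl _]; rewrite (extended_prod_rho n sl s00 pl).
  apply: le_trans (HK _ n.+1 _) _.
    move=> j; rewrite subr_ge0.
    have /(pathP 0) /(_ j) := pl; rewrite sl => /(_ (ltn_ord j)).
    by [].
  rewrite lee_fin le_eqVlt; apply/orP; left; apply/eqP; congr (K * _).
  rewrite (big_nth 0) size_pairmap sl big_mkord; apply: eq_bigr => j _.
  by rewrite (nth_pairmap 0) ?sl.
Qed.

End lacunary_products.

(** * Passage to the limit *)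

Lemma expe_fin_num {R : realType} (x : \bar R) (k : nat) : (0 <= x)%E ->
  (x ^+ k.+1)%E \is a fin_num -> x \is a fin_num.
Proof.
move=> x0; apply: contraLR; rewrite ge0_fin_numE// -leNgt leye_eq => /eqP ->.
rewrite expeS; have : (0 < +oo ^+ k :> \bar R)%E by apply: expe_gt0; rewrite ltry.
by move=> /gt0_mulye ->.
Qed.

Lemma cumulative_processE {d : measure_display} {T : measurableType d}
    {R : realType} (L : nat -> R -> T -> R) (n : nat) (t : R) (w : T) :
  cumulative_process L n t w = fine (cumul t (extended_prod L n) 0 w).
Proof.
congr fine; apply: eq_integral => s; rewrite inE/= in_itv/= => /andP[s0 _].
by rewrite /extended_prod (max_idPr s0).
Qed.

Section Lq_limit.
Context {d0 : measure_display} {T0 : measurableType d0} {R : realType}.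
Context {d : measure_display} {T : measurableType d}.
Variables (P0 : probability T0 R) (P : probability T R).
Variables (Lambda : R -> T0 -> R) (b : R) (L : nat -> R -> T -> R) (A : T -> R).
Variables (p : nat) (t : R).
Hypothesis hLambda : mother_process P0 Lambda.
Hypothesis hb : 1 < b.
Hypothesis hL : rescaled_copies P0 P Lambda b L.
Hypothesis p0 : (0 < p)%N.
Hypothesis hdecr : rho_decreasing P0 Lambda p.+1.
Hypothesis hmoment : (moment0 P0 Lambda p.+1 < (b ^+ p)%:E)%E.
Hypothesis hsum : (\sum_(1 <= n <oo)
  (rho P0 Lambda (fun _ : 'I_p.+1.-1 => (b ^+ n)%R) - 1) < +oo)%E.
Hypothesis hmix : mixing P0 Lambda p.+1.
Hypothesis t0 : 0 <= t.
Hypothesis t1 : t <= 1.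
Hypothesis mA : measurable_fun [set: T] A.
Hypothesis cvgA : {ae P, forall w, cumulative_process L n t w @[n --> \oo] --> A w}.

Let Y n w := cumulative_process L n t w.
Let F n w := cumul t (extended_prod L n) 0 w.
(** [A] is nonnegative only almost surely; [Z] is a version that is nonnegative everywhere. *)
Let Z (w : T) : R := `|A w|.

Let F0 n w : (0 <= F n w)%E.
Proof. by apply: cumul_ge0 => s v; exact: (extended_prod_ge0 hL). Qed.

Let mF n : measurable_fun [set: T] (F n).
Proof.
exact: (measurable_fun_pair2 (0 : MR R) (measurable_cumul t
  (measurable_extended_prod hL n) (extended_prod_ge0 hL n))).
Qed.

Let Y0 n w : 0 <= Y n w.
Proof. by rewrite /Y cumulative_processE fine_ge0// F0. Qed.

Let mY n : measurable_fun [set: T] (Y n).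
Proof.
have -> : Y n = fine \o F n by apply/funext => w; exact: cumulative_processE.
exact: (measurableT_comp (fine_measurable measurableT)).
Qed.

Let mZ : measurable_fun [set: T] Z. Proof. exact: measurableT_comp. Qed.

(** Finite moments of order [p.+1] make each [F n] almost surely finite. The default value 0 of the
    real integral then matters only on a null set, and facts about [F] carry over to [Y]. *)
Let F_fin : {ae P, forall w, forall n, F n w \is a fin_num}.
Proof.
have [S HS] := cumul_moments_bounded hLambda hb hL p0 hdecr hmoment hsum hmix t0 t1.
apply: ae_foralln => n.
have int : P.-integrable [set: T] (fun w => F n w ^+ p.+1)%E.
  apply/integrableP; split; first exact: measurable_expe.
  under eq_integral do rewrite gee0_abs ?expe_ge0//.
  exact: le_lt_trans (HS n) (ltry _).
apply: filterS (integrable_ae measurableT int) => w /(_ I).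
exact: expe_fin_num.
Qed.

Let FY n w : (forall n, F n w \is a fin_num) -> F n w = (Y n w)%:E.
Proof. by move=> Ffin; rewrite /Y cumulative_processE (fineK (Ffin n)). Qed.

Let YS : exists S : R, forall n, (\int[P]_w (Y n w ^+ p.+1)%:E <= S%:E)%E.
Proof.
have [S HS] := cumul_moments_bounded hLambda hb hL p0 hdecr hmoment hsum hmix t0 t1.
exists S => n; apply: le_trans (HS n); rewrite le_eqVlt; apply/orP; left; apply/eqP.
apply: ge0_ae_eq_integral => //.
- exact/measurable_EFinP/measurable_funX.
- exact: (measurable_expe _ (mF n)).
- by move=> w _; rewrite lee_fin exprn_ge0.
- by move=> w _; exact: (expe_ge0 _ (F0 n w)).
- by apply: filterS F_fin => w Ffin _; rewrite EFin_expe -FY.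
Qed.

Let martY n m : (n <= m)%N ->
  (\int[P]_w (Y n w ^+ p * Y m w)%:E = \int[P]_w (Y n w ^+ p.+1)%:E)%E.
Proof.
move=> nm.
(* The identity is proved for the extended-valued integrals, where Tonelli's theorem applies, and
   carried over almost everywhere. *)
transitivity (\int[P]_w (F n w ^+ p * F m w))%E.
  apply: ge0_ae_eq_integral => //.
  - by apply/measurable_EFinP; apply: measurable_funM => //; exact: measurable_funX.
  - by apply: emeasurable_funM => //; exact: measurable_expe.
  - by move=> w _; rewrite lee_fin mulr_ge0// exprn_ge0.
  - by move=> w _; rewrite mule_ge0// expe_ge0.
  - by apply: filterS F_fin => w Ffin _; rewrite EFinM EFin_expe -!FY.
transitivity (\int[P]_w (F n w ^+ p.+1))%E.
  apply: cumul_martingale.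
  - exact: (measurable_extended_prod hL).
  - exact: (measurable_extended_prod hL).
  - exact: (extended_prod_ge0 hL).
  - exact: (extended_prod_ge0 hL).
  - by move=> l s; exact: (extended_prod_mart hLambda hb hL).
apply: ge0_ae_eq_integral => //.
- exact: (measurable_expe _ (mF n)).
- exact/measurable_EFinP/measurable_funX.
- by move=> w _; exact: (expe_ge0 _ (F0 n w)).
- by move=> w _; rewrite lee_fin exprn_ge0.
- by apply: filterS F_fin => w Ffin _; rewrite EFin_expe -FY.
Qed.

Let AZ : {ae P, forall w, A w = Z w}.
Proof.
apply: filterS cvgA => w YA.
suff A0 : 0 <= A w by rewrite /Z ger0_norm.
by apply: (cvgr_to_ge YA); apply: nearW => n; exact: Y0.
Qed.

Let cvgYZ : {ae P, forall w, Y n w @[n --> \oo] --> Z w}.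
Proof. by apply: filterS2 cvgA AZ => w YA <-. Qed.

Lemma limit_moment_finite : ('E_P[fun w => (A w ^+ p.+1)%R] < +oo)%E.
Proof.
have [S HS] := YS; rewrite expectation.unlock.
have := fatou_limit mY Y0 mZ cvgYZ HS; move/le_lt_trans => /(_ _ (ltry _)).
apply: le_lt_trans; rewrite le_eqVlt; apply/orP; left; apply/eqP.
apply: ae_eq_integral => //.
- exact/measurable_EFinP/measurable_funX.
- exact/measurable_EFinP/measurable_funX.
- by apply: filterS AZ => w <-.
Qed.

Let D (n : nat) (w : T) : R := `|Y n w - A w|.

Let mD n : measurable_fun [set: T] (D n).
Proof. by apply: measurableT_comp => //; exact: measurable_funB. Qed.

Let cvgD : (\int[P]_w (D n w ^+ p.+1)%:E @[n --> \oo] --> 0)%E.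
Proof.
have [S HS] := YS.
have := cvg_Lq_dist p0 mY Y0 mZ (fun w => normr_ge0 _) cvgYZ HS martY.
suff -> : (fun n => \int[P]_w (`|Y n w - Z w| ^+ p.+1)%:E)%E =
    (fun n => \int[P]_w (D n w ^+ p.+1)%:E)%E by [].
apply/funext => n; apply: ae_eq_integral => //.
- apply/measurable_EFinP/measurable_funX.
  by apply: measurableT_comp => //; exact: measurable_funB.
- exact/measurable_EFinP/measurable_funX.
- by apply: filterS AZ => w <-.
Qed.

Lemma cumulative_cvg_Lp (r : R) : 0 <= r -> r <= p.+1%:R ->
  cvg_Lp P (fun n => cumulative_process L n t) A r.
Proof.
move=> r0 rp; rewrite /cvg_Lp; case: eqP => [_ e e0|/eqP rn0].
  exact: (cvg_in_probability mD (fun n w => normr_ge0 _) cvgD e0).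
have rgt0 : 0 < r by rewrite lt0r rn0.
rewrite expectation.unlock.
exact: (cvg_lower_moment mD (fun n w => normr_ge0 _) cvgD rgt0 rp).
Qed.

End Lq_limit.

Theorem theorem2 (R : realType)
  (d0 : measure_display) (T0 : measurableType d0) (P0 : probability T0 R)
  (d : measure_display) (T : measurableType d) (P : probability T R)
  (Lambda : R -> T0 -> R) (b : R) (L : nat -> R -> T -> R)
  (A : R -> T -> R) (q : nat)
  (hLambda : mother_process P0 Lambda)
  (hb : 1 < b)
  (hL : rescaled_copies P0 P Lambda b L)
  (hcadlag : forall n,
    {ae P, forall w, cadlag01 (fun t => cumulative_process L n t w)})
  (hA : forall t, 0 <= t <= 1 ->
    measurable_fun [set: T] (A t) /\
    {ae P, forall w, cumulative_process L n t w @[n --> \oo] --> A t w})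
  (hq : (2 <= q)%N)
  (hdecr : rho_decreasing P0 Lambda q)
  (hmoment : (moment0 P0 Lambda q < (b ^+ q.-1)%:E)%E)
  (hsum : (\sum_(1 <= n <oo)
     (rho P0 Lambda (fun _ : 'I_q.-1 => (b ^+ n)%R) - 1) < +oo)%E)
  (hmix : mixing P0 Lambda q) :
  forall t, 0 <= t <= 1 ->
    [/\ ('E_P[fun w => (A t w ^+ q)%R] < +oo)%E,
        cvg_Lp P (fun n => cumulative_process L n t) (A t) q%:R
      & forall p : R, 0 <= p <= q%:R ->
        cvg_Lp P (fun n => cumulative_process L n t) (A t) p].
Proof.
move=> t /andP[t0 t1]; have [mA cvgA] := hA t (introT andP (conj t0 t1)).
(* With [q = p.+1], the hypothesis [2 <= q] becomes [0 < p] by conversion. *)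
case: q hq hdecr hmoment hsum hmix => // p p1 decr moment sum mix.
have lim_fin := limit_moment_finite hLambda hb hL p1 decr moment sum mix t0 t1 mA cvgA.
have cvg r r0 rp :=
  @cumulative_cvg_Lp _ _ _ _ _ _ _ _ _ _ _ _ _ hLambda hb hL p1 decr moment sum mix
    t0 t1 mA cvgA r r0 rp.
split => //; first exact: cvg.
by move=> r /andP[r0 rp]; exact: cvg.
Qed.
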